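(* Let $p$ be a prime and let $E/\mathbf{Q}_p$ be an elliptic curve given by a Weierstrass equation over $\mathbf{Z}_p$ $$Y^2 + a_1 XY + a_3 Y = X^3 + a_2 X^2 + a_4 X + a_6$$ with $a_i \in p\mathbf{Z}_p$ for each $i$. Then $E_0(\mathbf{Q}_p) \cong \mathbf{Z}_p$ as $\mathbf{Z}_p$-modules, unless one is in one of the following four special cases: (i) $p=2$ and $a_1+a_3 \equiv 2 \pmod{4}$; (ii) $p=3$ and $a_2 \equiv 6 \pmod{9}$; (iii) $p=5$ and $a_4 \equiv 10 \pmod{25}$; (iv) $p=7$ and $a_6 \equiv 14 \pmod{49}$. In all special cases one has $E_0(\mathbf{Q}_p) \cong \mathbf{Z}_p \times \mathbf{Z}/p\mathbf{Z}$ as $\mathbf{Z}_p$-modules.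
   Context: $E_0(\mathbf{Q}_p)\subset E(\mathbf{Q}_p)$ is the subgroup of points whose reduction modulo $p$ (with respect to the given Weierstrass equation) is a non-singular point of the reduced curve over $\mathbf{F}_p$. The group $E_0(\mathbf{Q}_p)$ carries a $\mathbf{Z}_p$-module structure extending its $\mathbf{Z}$-module structure (for $a\in\mathbf{Z}_p$ and integers $m_j\to a$ $p$-adically, $aP=\lim_j m_jP$ in the $p$-adic topology of $E(\mathbf{Q}_p)$). *)

(* Defs.v *)
From HB Require Import structures.
From mathcomp Require Import all_boot all_order all_algebra.
From mathcomp Require Import boolp.
From mathcomp Require Import mpoly.

Set Implicit Arguments.
Unset Strict Implicit.
Unset Printing Implicit Defensive.

Import GRing.Theory Num.Theory.
Local Open Scope ring_scope.

(* The ring of p-adic integers as the inverse limit of the rings Z/p^n: an    *)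
(* element is the sequence of its residues modulo p^n. The coherence          *)
(* condition also forces the n-th term into {0, ..., p^n - 1}, so that        *)
(* Leibniz equality of sequences is equality of p-adic integers. The type     *)
(* depends on the primality proof because it is an integral domain only for   *)
(* prime p.                                                                   *)

Definition padic_coherent (p : nat) (x : nat -> int) : Prop :=
  forall n, x n = (x n.+1 %% p%:Z ^+ n)%Z.

Record padic_int (p : nat) (p_pr : prime p) := PadicInt {
  residue :> nat -> int;
  _ : `[< padic_coherent p residue >]
}.

HB.instance Definition _ p (p_pr : prime p) :=
  [isSub of padic_int p_pr for @residue p p_pr].
HB.instance Definition _ p (p_pr : prime p) :=
  [Choice of padic_int p_pr by <:].

Section PadicInt.

Variables (p : nat) (p_pr : prime p).
Implicit Types x y z : padic_int p_pr.

Local Notation q n := (p%:Z ^+ n).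

Lemma residueS x n : x n = (x n.+1 %% q n)%Z.
Proof. by have /asboolP := valP x; apply. Qed.

Lemma residue_mod x n : (x n %% q n)%Z = x n.
Proof. by rewrite residueS modz_mod. Qed.

Lemma padic_eqP x y : (forall n, x n = y n %[mod q n])%Z -> x = y.
Proof.
move=> h; apply/val_inj/funext => n /=.
by rewrite -residue_mod h residue_mod.
Qed.

Lemma modz_exp (m : int) n k : ((m %% q (n + k))%Z %% q n)%Z = (m %% q n)%Z.
Proof.
apply/esym/eqP; rewrite eqz_mod_dvd {1}(divz_eq m (q (n + k))) addrK.
by rewrite exprD mulrA -mulrAC dvdz_mull.
Qed.

Lemma residue_exp x n k : (x (n + k)%N %% q n)%Z = x n.
Proof.
elim: k => [|k IHk]; first by rewrite addn0 residue_mod.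
by rewrite -IHk [x (n + k)%N]residueS modz_exp addnS.
Qed.

Lemma padic_seq_subproof (u : nat -> int) :
    (forall n, u n = u n.+1 %[mod q n])%Z ->
  `[< padic_coherent p (fun n => (u n %% q n)%Z) >].
Proof. by move=> h; apply/asboolP => n; rewrite -addn1 modz_exp addn1. Qed.

Definition padic_seq u h : padic_int p_pr := PadicInt p_pr (@padic_seq_subproof u h).

Fact padic_const_subproof (m : int) n : (m = m %[mod q n])%Z.
Proof. by []. Qed.

Fact padic_opp_subproof x n : (- x n = - x n.+1 %[mod q n])%Z.
Proof. by rewrite [x n]residueS modzNm. Qed.

Fact padic_add_subproof x y n :
  (x n + y n = x n.+1 + y n.+1 %[mod q n])%Z.
Proof. by rewrite [x n]residueS [y n]residueS modzDm. Qed.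

Fact padic_mul_subproof x y n :
  (x n * y n = x n.+1 * y n.+1 %[mod q n])%Z.
Proof. by rewrite [x n]residueS [y n]residueS modzMm. Qed.

Definition padic_const m := padic_seq (@padic_const_subproof m).
Definition padic_opp x := padic_seq (padic_opp_subproof x).
Definition padic_add x y := padic_seq (padic_add_subproof x y).
Definition padic_mul x y := padic_seq (padic_mul_subproof x y).

Fact padic_addA : associative padic_add.
Proof.
by move=> x y z; apply/padic_eqP => n /=; rewrite !modz_mod modzDml modzDmr addrA.
Qed.

Fact padic_addC : commutative padic_add.
Proof. by move=> x y; apply/padic_eqP => n /=; rewrite addrC. Qed.

Fact padic_add0 : left_id (padic_const 0) padic_add.
Proof. by move=> x; apply/padic_eqP => n /=; rewrite !modz_mod modzDml add0r. Qed.

Fact padic_addN : left_inverse (padic_const 0) padic_opp padic_add.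
Proof. by move=> x; apply/padic_eqP => n /=; rewrite modzDml addNr. Qed.

Fact padic_mulA : associative padic_mul.
Proof.
by move=> x y z; apply/padic_eqP => n /=; rewrite !modz_mod modzMml modzMmr mulrA.
Qed.

Fact padic_mulC : commutative padic_mul.
Proof. by move=> x y; apply/padic_eqP => n /=; rewrite mulrC. Qed.

Fact padic_mul1 : left_id (padic_const 1) padic_mul.
Proof. by move=> x; apply/padic_eqP => n /=; rewrite !modz_mod modzMml mul1r. Qed.

Fact padic_mulDl : left_distributive padic_mul padic_add.
Proof.
by move=> x y z; apply/padic_eqP => n /=; rewrite !modz_mod modzMml modzDm mulrDl.
Qed.

Fact padic_1neq0 : padic_const 1 != padic_const 0.
Proof.
apply/eqP => /(congr1 (fun x : padic_int p_pr => x 1)) /= /eqP.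
rewrite eqz_mod_dvd subr0 expr1 dvdz1 /=; move: p_pr.
by case: p p_pr => [|[|]].
Qed.

HB.instance Definition _ := GRing.isZmodule.Build (padic_int p_pr)
  padic_addA padic_addC padic_add0 padic_addN.
HB.instance Definition _ := GRing.Zmodule_isComNzRing.Build (padic_int p_pr)
  padic_mulA padic_mulC padic_mul1 padic_mulDl padic_1neq0.

Definition padic_unit : pred (padic_int p_pr) :=
  fun x => `[< exists y, y * x = 1 >].

Definition padic_inv x : padic_int p_pr :=
  if pselect (exists y, y * x = 1) is left ex then sval (cid ex) else x.

Fact padic_mulV : {in padic_unit, left_inverse 1 padic_inv *%R}.
Proof.
move=> x /asboolP ex; rewrite /padic_inv; case: pselect => // ex'.
by case: cid.
Qed.

Fact padic_unitP x y : y * x = 1 -> padic_unit x.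
Proof. by move=> yx1; apply/asboolP; exists y. Qed.

Fact padic_inv_out : {in [predC padic_unit], padic_inv =1 id}.
Proof.
move=> x /= /negP xU; rewrite /padic_inv; case: pselect => // ex.
by case: xU; apply/asboolP.
Qed.

HB.instance Definition _ := GRing.ComNzRing_hasMulInverse.Build
  (padic_int p_pr) padic_mulV padic_unitP padic_inv_out.

Lemma prime_exp_dvdM (a b n m : nat) :
  (p ^ (n + m) %| a * b -> (p ^ n %| a) || (p ^ m %| b))%N.
Proof.
have [->|a0] := posnP a; first by rewrite dvdn0.
have [->|b0] := posnP b; first by rewrite dvdn0 orbT.
rewrite !pfactor_dvdn ?muln_gt0 ?a0 ?b0 // lognM //.
apply: contraLR; rewrite negb_or -!ltnNge => /andP[an bm].
by rewrite -addSn leq_add // ltnW.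
Qed.

Fact padic_idomain : GRing.integral_domain_axiom (padic_int p_pr).
Proof.
move=> x y xy0; apply: contraT; rewrite negb_or => /andP[/eqP x0 /eqP y0].
have nz z : z <> 0 -> exists n, ~~ (q n %| z n)%Z.
  move=> z0; apply: contrapT => h; apply: z0; apply/padic_eqP => n /=.
  rewrite modz_mod mod0z; apply/eqP; apply/negPn/negP => zn; apply: h; exists n.
  by apply/negP => /dvdz_mod0P; apply/eqP.
have [n xn] := nz x x0; have [m ym] := nz y y0.
have : (q (n + m) %| x (n + m)%N * y (n + m)%N)%Z.
  apply/dvdz_mod0P; have := congr1 (fun z : padic_int p_pr => z (n + m)%N) xy0.
  by rewrite /= mod0z.
rewrite dvdzE abszM abszX absz_nat => /prime_exp_dvdM /orP[] h.
  case/negP: xn; rewrite -(residue_exp x n m); apply/dvdz_mod0P.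
  by rewrite modz_mod; apply/dvdz_mod0P; rewrite dvdzE abszX absz_nat.
case/negP: ym; rewrite -(residue_exp y m n); apply/dvdz_mod0P.
by rewrite modz_mod; apply/dvdz_mod0P; rewrite addnC dvdzE abszX absz_nat.
Qed.

HB.instance Definition _ := GRing.ComUnitRing_isIntegral.Build
  (padic_int p_pr) padic_idomain.

Definition padic_num : Type := {fraction padic_int p_pr}.
HB.instance Definition _ := GRing.Field.on padic_num.

Definition padic_red x : 'F_p := (x 1)%:~R.

Lemma intr_modz_Fp (m : int) : (m %% q 1)%Z%:~R = m%:~R :> 'F_p.
Proof.
by rewrite /modz expr1 intrB intrM -[p%:Z%:~R]/(p%:R) pchar_Fp_0 // mulr0 subr0.
Qed.

Fact padic_red_is_zmod_morphism : zmod_morphism padic_red.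
Proof.
by move=> x y; rewrite /padic_red /= intr_modz_Fp intrD intr_modz_Fp intrN.
Qed.

Fact padic_red_is_monoid_morphism : monoid_morphism padic_red.
Proof.
by split=> [|x y]; rewrite /padic_red /= intr_modz_Fp ?intrM.
Qed.

HB.instance Definition _ := GRing.isZmodMorphism.Build
  (padic_int p_pr) 'F_p padic_red padic_red_is_zmod_morphism.
HB.instance Definition _ := GRing.isMonoidMorphism.Build
  (padic_int p_pr) 'F_p padic_red padic_red_is_monoid_morphism.

End PadicInt.

Definition Zmodp (p : nat) (p_pr : prime p) : Type := 'F_p.

Section Zmodp.

Variables (p : nat) (p_pr : prime p).

HB.instance Definition _ := GRing.Zmodule.copy (Zmodp p_pr) 'F_p.

Definition Zmodp_scale (a : padic_int p_pr) (x : Zmodp p_pr) : Zmodp p_pr :=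
  padic_red a * (x : 'F_p).

Fact Zmodp_scaleA a b x :
  Zmodp_scale a (Zmodp_scale b x) = Zmodp_scale (a * b) x.
Proof. by rewrite /Zmodp_scale rmorphM mulrA. Qed.

Fact Zmodp_scale1 : left_id 1 Zmodp_scale.
Proof. by move=> x; rewrite /Zmodp_scale rmorph1 mul1r. Qed.

Fact Zmodp_scaleDr : right_distributive Zmodp_scale +%R.
Proof. by move=> a x y; rewrite /Zmodp_scale mulrDr. Qed.

Fact Zmodp_scaleDl x : {morph Zmodp_scale^~ x : a b / a + b}.
Proof. by move=> a b; rewrite /Zmodp_scale rmorphD mulrDl. Qed.

HB.instance Definition _ := GRing.Zmodule_isLmodule.Build
  (padic_int p_pr) (Zmodp p_pr)
  Zmodp_scaleA Zmodp_scale1 Zmodp_scaleDr Zmodp_scaleDl.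

End Zmodp.

Record weierstrass (R : Type) := Weierstrass {
  wa1 : R; wa2 : R; wa3 : R; wa4 : R; wa6 : R
}.

Definition map_weierstrass (R S : Type) (f : R -> S) (E : weierstrass R) :=
  Weierstrass (f (wa1 E)) (f (wa2 E)) (f (wa3 E)) (f (wa4 E)) (f (wa6 E)).

Section Cubic.

Variables (R : comNzRingType) (E : weierstrass R).
Local Notation a1 := (wa1 E).
Local Notation a2 := (wa2 E).
Local Notation a3 := (wa3 E).
Local Notation a4 := (wa4 E).
Local Notation a6 := (wa6 E).

Definition discriminant : R :=
  let b2 := a1 ^+ 2 + 4 * a2 in
  let b4 := 2 * a4 + a1 * a3 in
  let b6 := a3 ^+ 2 + 4 * a6 in
  let b8 := a1 ^+ 2 * a6 + 4 * a2 * a6 - a1 * a3 * a4 + a2 * a3 ^+ 2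
            - a4 ^+ 2 in
  - b2 ^+ 2 * b8 - 8 * b4 ^+ 3 - 27 * b6 ^+ 2 + 9 * b2 * b4 * b6.

(* The cubic form whose zero locus in P^2 is the projective closure of the    *)
(* affine Weierstrass curve.                                                  *)
Definition cubic_form : {mpoly R[3]} :=
  let X : {mpoly R[3]} := 'X_(inord 0) in
  let Y : {mpoly R[3]} := 'X_(inord 1) in
  let Z : {mpoly R[3]} := 'X_(inord 2) in
  Y ^+ 2 * Z + a1 *: (X * Y * Z) + a3 *: (Y * Z ^+ 2)
  - (X ^+ 3 + a2 *: (X ^+ 2 * Z) + a4 *: (X * Z ^+ 2) + a6 *: Z ^+ 3).

(* v is a vector of homogeneous coordinates, not all zero. *)
Definition nonsingular_point (v : 'I_3 -> R) : Prop :=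
  [/\ exists i, v i != 0,
      cubic_form.@[v] = 0
    & exists i, (mderiv i cubic_form).@[v] != 0].

End Cubic.

Inductive point (K : Type) := Infinity | Affine of K & K.
Arguments Infinity {K}.

Definition homogeneous (K : nzRingType) (P : point K) : 'I_3 -> K :=
  if P is Affine x y then tnth [tuple x; y; 1] else tnth [tuple 0; 1; 0].

Section GroupLaw.

Variables (K : fieldType) (E : weierstrass K).
Local Notation a1 := (wa1 E).
Local Notation a2 := (wa2 E).
Local Notation a3 := (wa3 E).
Local Notation a4 := (wa4 E).
Local Notation a6 := (wa6 E).

Definition on_curve (P : point K) : bool :=
  if P is Affine x y then
    y ^+ 2 + a1 * x * y + a3 * y == x ^+ 3 + a2 * x ^+ 2 + a4 * x + a6
  else true.

Definition opp_point (P : point K) : point K :=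
  if P is Affine x y then Affine x (- y - a1 * x - a3) else Infinity.

(* lam and nu are the slope and the intercept of the line through the two     *)
(* points (of the tangent line, if they coincide).                            *)
Definition add_point (P Q : point K) : point K :=
  match P, Q with
  | Infinity, _ => Q
  | _, Infinity => P
  | Affine x1 y1, Affine x2 y2 =>
    if (x1 == x2) && (y1 + y2 + a1 * x2 + a3 == 0) then Infinity else
    let lam :=
      if x1 == x2
      then (3 * x1 ^+ 2 + 2 * a2 * x1 + a4 - a1 * y1) / (2 * y1 + a1 * x1 + a3)
      else (y2 - y1) / (x2 - x1) in
    let nu := y1 - lam * x1 in
    let x3 := lam ^+ 2 + a1 * lam - a2 - x1 - x2 in
    Affine x3 (- (lam + a1) * x3 - nu - a3)
  end.

Definition mulz_point (m : int) (P : point K) : point K :=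
  match m with
  | Posz n => iter n (add_point P) Infinity
  | Negz n => opp_point (iter n.+1 (add_point P) Infinity)
  end.

End GroupLaw.

Section PadicCurve.

Variables (p : nat) (p_pr : prime p).
Local Notation Zp := (padic_int p_pr).
Local Notation Qp := (padic_num p_pr).
Local Notation "x %:F" := (@FracField.tofrac (padic_int p_pr) x).

(* x belongs to the ideal generated by m. *)
Definition in_ideal (m : nat) (x : Zp) : Prop := exists c : Zp, x = m%:R * c.

Definition padic_cvg (u : nat -> Qp) (l : Qp) : Prop :=
  forall n, exists N, forall j, (N <= j)%N ->
    exists c : Zp, u j - l = (p%:R ^+ n * c)%:F.

(* Convergence in the quotient topology of P^2(Qp): suitable homogeneous      *)
(* coordinates of the points converge to homogeneous coordinates of the limit *)
Definition point_cvg (P : nat -> point Qp) (Q : point Qp) : Prop :=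
  exists c : nat -> Qp, (forall j, c j != 0) /\
    forall i, padic_cvg (fun j => c j * homogeneous (P j) i) (homogeneous Q i).

Variable E : weierstrass Zp.

Definition generic_fibre : weierstrass Qp :=
  map_weierstrass (fun a => a%:F) E.

Definition special_fibre : weierstrass 'F_p :=
  map_weierstrass (@padic_red p p_pr) E.

(* v is a vector of homogeneous coordinates of P in Zp; requiring its         *)
(* reduction to be nonzero makes v primitive, and then the reduction of v     *)
(* represents the reduction of P.                                             *)
Definition E0 (P : point Qp) : Prop :=
  on_curve generic_fibre P /\
  exists (c : Qp) (v : 'I_3 -> Zp),
    [/\ c != 0,
        forall i, c * homogeneous P i = (v i)%:F
      & nonsingular_point special_fibre (fun i => padic_red (v i))].

(* Q = a P, where a P is the limit of the m_j P for integers m_j -> a. *)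
Definition padic_multiple (a : Zp) (P Q : point Qp) : Prop :=
  forall m : nat -> int, padic_cvg (fun j => (m j)%:~R) a%:F ->
    point_cvg (fun j => mulz_point generic_fibre (m j) P) Q.

Definition E0_isomorphic (V : lmodType Zp) : Prop :=
  exists phi : V -> point Qp,
    [/\ injective phi,
        forall P, E0 P <-> exists v, phi v = P,
        forall u v, phi (u + v) = add_point generic_fibre (phi u) (phi v)
      & forall a v, padic_multiple a (phi v) (phi (a *: v))].

Definition special_case : Prop :=
  [\/ p = 2%N /\ in_ideal 4 (wa1 E + wa3 E - 2),
      p = 3%N /\ in_ideal 9 (wa2 E - 6),
      p = 5%N /\ in_ideal 25 (wa4 E - 10)
    | p = 7%N /\ in_ideal 49 (wa6 E - 14)].

End PadicCurve.

(* Main.v *)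
(* In the coordinates z = -x/y, w = -1/y the curve is
     w = z^3 + a1 z w + a2 z^2 w + a3 w^2 + a4 z w^2 + a6 w^3,
   whose right-hand side is a contraction in w because p divides every a_i.
   So w is a function of z, and z maps E_0(Q_p) bijectively onto all of Z_p.
   The group law becomes z1 + z2 + p z1 z2 u with u in Z_p, hence multiplication
   by p maps p^n Z_p \ p^(n+1) Z_p to p^(n+1) Z_p \ p^(n+2) Z_p for n >= 1, and
   the group is isomorphic to Z_p or to Z_p x Z/pZ according to whether the same
   holds for n = 0. Modulo p^2 the group law is linear in the a_i, which gives
   [p] z = p z t modulo p^2 for a constant t depending only on the a_i modulo
   p^2, and p divides t exactly in the four special cases.
   Associativity is a rational identity between slopes of chords for points in
   general position, and extends to all of Z_p by continuity. *)

(* Working with lines in the (z, w)-plane makes one formula cover chords, tangents and the neutral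
   point: the denominator of the slope and the leading coefficient of the cubic on a line are both 1
   modulo p, hence units. The price is associativity, where the chord identity needs distinct
   x-coordinates; every degenerate position is reached by approximation. The four primes come from
   integration. The coefficient a_i has weight i, so its first-order contribution to the logarithm l
   is a term in z^(i+1) with denominator i+1 = 2, 3, 4, 5, 7, the 4 dropping to 2. In p l(z) - l(p
   z) such a term carries the integer (p - p^k)/c, with k = i+1 and c the reduced denominator. It is
   divisible by p unless c = p; then Fermat's congruence merges the term with the linear one. This
   is why both a_1 and a_3 matter for p = 2. The isomorphism is not obtained from a logarithm: it
   sends a to aP for one point P, as a limit of integer multiples. *)
From HB Require Import structures.
Require Import Defs.
From mathcomp Require Import all_boot all_order all_algebra.
From mathcomp Require Import boolp mpoly ring zify.

Set Implicit Arguments.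
Unset Strict Implicit.
Unset Printing Implicit Defensive.

Import GRing.Theory Num.Theory.
Local Open Scope ring_scope.

(** Reduces an equation that follows from a hypothesis to an identity for [ring] or [field]; [k] is
    the multiplier of the hypothesis. *)
Lemma eq_lincomb (R : nzRingType) (k a b x y : R) :
  a = b -> x - y = k * (a - b) -> x = y.
Proof. by move=> -> /eqP; rewrite subrr mulr0 subr_eq0 => /eqP. Qed.

Lemma eq_lincomb2 (R : nzRingType) (k l a b c d x y : R) :
  a = b -> c = d -> x - y = k * (a - b) + l * (c - d) -> x = y.
Proof.
by move=> -> -> /eqP; rewrite !subrr !mulr0 addr0 subr_eq0 => /eqP.
Qed.

(** * Congruences modulo an element of a ring *)

Section Congruence.

Variable R : comUnitRingType.
Implicit Types d x y : R.

Definition cong d x y := exists c, x - y = d * c.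

Lemma cong_refl d x : cong d x x.
Proof. by exists 0; rewrite subrr mulr0. Qed.

Lemma cong_sym d x y : cong d x y -> cong d y x.
Proof. by case=> c h; exists (- c); rewrite mulrN -h opprB. Qed.

Lemma cong_trans d x y z : cong d x y -> cong d y z -> cong d x z.
Proof. by case=> c h [e k]; exists (c + e); rewrite mulrDr -h -k; ring. Qed.

Lemma congD d x x' y y' : cong d x x' -> cong d y y' -> cong d (x + y) (x' + y').
Proof. by case=> c h [e k]; exists (c + e); rewrite mulrDr -h -k; ring. Qed.

Lemma congN d x x' : cong d x x' -> cong d (- x) (- x').
Proof. by case=> c h; exists (- c); rewrite mulrN -h; ring. Qed.

Lemma congM d x x' y y' : cong d x x' -> cong d y y' -> cong d (x * y) (x' * y').
Proof.
case=> c h [e k]; exists (c * y + x' * e).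
have -> : d * (c * y + x' * e) = (d * c) * y + x' * (d * e) by ring.
by rewrite -h -k; ring.
Qed.

Lemma congX d x x' n : cong d x x' -> cong d (x ^+ n) (x' ^+ n).
Proof.
move=> h; elim: n => [|n IHn]; first exact: cong_refl.
by rewrite !exprS; apply: congM.
Qed.

Lemma congV d x x' : x \is a GRing.unit -> x' \is a GRing.unit ->
  cong d x x' -> cong d x^-1 x'^-1.
Proof.
move=> ux ux' [c h]; exists (- c / x / x').
by rewrite !mulrA mulrN -h opprB !mulrBl divrr // mul1r mulrAC divrr // mul1r.
Qed.

End Congruence.

(** * Associativity of chord addition in general position *)

Section ChordAssociativity.

Variables (K : fieldType) (E : weierstrass K).
Local Notation a1 := (wa1 E).
Local Notation a2 := (wa2 E).
Local Notation a3 := (wa3 E).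
Local Notation a4 := (wa4 E).
Local Notation a6 := (wa6 E).

(** The slope is an argument, so that identities between slopes can be used without division or case
    analysis. *)
Definition chord (l x1 y1 x2 : K) : point K :=
  let x3 := l ^+ 2 + a1 * l - a2 - x1 - x2 in
  Affine x3 (- (l + a1) * x3 - (y1 - l * x1) - a3).

Lemma add_chord l x1 y1 x2 y2 : x1 != x2 -> y2 - y1 = l * (x2 - x1) ->
  add_point E (Affine x1 y1) (Affine x2 y2) = chord l x1 y1 x2.
Proof.
move=> x12 h; rewrite /add_point (negPf x12) /=.
have -> : (y2 - y1) / (x2 - x1) = l by rewrite h mulfK // subr_eq0 eq_sym.
by [].
Qed.

Lemma add_tangent l x y : 2 * y + a1 * x + a3 != 0 ->
  3 * x ^+ 2 + 2 * a2 * x + a4 - a1 * y = l * (2 * y + a1 * x + a3) ->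
  add_point E (Affine x y) (Affine x y) = chord l x y x.
Proof.
move=> d0 h; rewrite /add_point eqxx /=.
have -> : y + y + a1 * x + a3 = 2 * y + a1 * x + a3 by ring.
by rewrite (negPf d0) h mulfK.
Qed.

(* If the chords through P1,P2 and P2,P3 and P1+P2,P3 have slopes k, m and n, then
   the chord through P1 and P2+P3 has slope n + k - m. This comes down to
   x3 - x1 = (m - k) (n + k + a1), proved by moving P2 to the origin and the chord
   through P1,P2 to the line y = 0. *)
Lemma chord_assoc x1 y1 x2 y2 x3 y3 x12 y12 x23 y23 :
  on_curve E (Affine x1 y1) -> on_curve E (Affine x2 y2) ->
  on_curve E (Affine x3 y3) ->
  add_point E (Affine x1 y1) (Affine x2 y2) = Affine x12 y12 ->
  add_point E (Affine x2 y2) (Affine x3 y3) = Affine x23 y23 ->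
  x1 != x2 -> x2 != x3 -> x12 != x3 -> x1 != x23 ->
  add_point E (Affine x12 y12) (Affine x3 y3) =
  add_point E (Affine x1 y1) (Affine x23 y23).
Proof.
move=> /eqP e1 /eqP e2 /eqP e3 E12 E23 d12 d23 d123 d1.
pose k := (y2 - y1) / (x2 - x1).
have hk : y2 - y1 = k * (x2 - x1) by rewrite divfK // subr_eq0 eq_sym.
pose m := (y3 - y2) / (x3 - x2).
have hm : y3 - y2 = m * (x3 - x2) by rewrite divfK // subr_eq0 eq_sym.
pose n := (y3 - y12) / (x3 - x12).
have hn : y3 - y12 = n * (x3 - x12) by rewrite divfK // subr_eq0 eq_sym.
rewrite (add_chord d12 hk) in E12; rewrite (add_chord d23 hm) in E23.
case: E12 E23 => X12 Y12 [X23 Y23].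
have {}Y12 : y12 = - (k + a1) * x12 - (y1 - k * x1) - a3 by rewrite -X12 -Y12.
have {}Y23 : y23 = - (m + a1) * x23 - (y2 - m * x2) - a3 by rewrite -X23 -Y23.
have y1E : y1 = y2 - k * (x2 - x1) by rewrite -hk; ring.
have y3E : y3 = y2 + m * (x3 - x2) by rewrite -hm; ring.
pose u := x1 - x2; pose r := x3 - x2; pose M := m - k.
have u0 : u != 0 by rewrite subr_eq0.
have r0 : r != 0 by rewrite subr_eq0 eq_sym.
(* Here [r - u = x3 - x1]. On the chord through P1 and P2 the curve equation becomes (x - x1)(x -
   x2)(x - x12); [key0] evaluates it at P3, whose height above that chord is [M * r], and divides by
   [r]. The combination of the three curve equations below is a second divided difference. *)
have key0 : M * (M * r + (a1 + 2 * k) * r + (2 * y2 + a1 * x2 + a3))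
    = (r - u) * (x3 - x12).
  apply/eqP; rewrite -subr_eq0 -(mulrI_eq0 _ (mulfI r0)) -(mulrI_eq0 _ (mulfI u0)).
  apply/eqP; rewrite y1E in e1; rewrite y3E in e3.
  apply: (@etrans _ _ (u * ((y2 + m * (x3 - x2)) ^+ 2 + a1 * x3 * (y2 + m * (x3 - x2)) +
     a3 * (y2 + m * (x3 - x2)) - (x3 ^+ 3 + a2 * x3 ^+ 2 + a4 * x3 + a6))
     + (r - u) * (y2 ^+ 2 + a1 * x2 * y2 + a3 * y2 -
        (x2 ^+ 3 + a2 * x2 ^+ 2 + a4 * x2 + a6))
     - r * ((y2 - k * (x2 - x1)) ^+ 2 + a1 * x1 * (y2 - k * (x2 - x1)) +
       a3 * (y2 - k * (x2 - x1)) - (x1 ^+ 3 + a2 * x1 ^+ 2 + a4 * x1 + a6)))).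
    by rewrite -X12 /u /r /M; ring.
  by rewrite e1 e2 e3; ring.
have key : x3 - x1 = M * (n + k + a1).
  have d0 : x3 - x12 != 0 by rewrite subr_eq0 eq_sym.
  apply: (mulIf d0); move: hn; rewrite Y12 y1E y3E => hn.
  apply: (@etrans _ _ ((r - u) * (x3 - x12))); first by rewrite /r /u; ring.
  rewrite -key0 /M /r; apply: (eq_lincomb (k := m - k) hn); ring.
rewrite (add_chord d123 hn).
have -> : add_point E (Affine x1 y1) (Affine x23 y23) =
    chord (n + k - m) x1 y1 x23.
  apply: (add_chord d1).
  apply: (eq_lincomb2 (k := -1) (l := m + k + a1) hn key).
  by rewrite Y12 Y23 y1E y3E -X12 -X23 /M; ring.
have Ex : (n + k - m) ^+ 2 + a1 * (n + k - m) - a2 - x1 - x23 =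
          n ^+ 2 + a1 * n - a2 - x12 - x3.
  by apply: (eq_lincomb (k := 2) key); rewrite -X12 -X23 /M; ring.
rewrite /chord Ex; congr Affine.
apply: (eq_lincomb2 (k := 1) (l := n - k) hn key).
by rewrite Y12 y1E y3E -X12 /M; ring.
Qed.

End ChordAssociativity.

(** * The group law in the coordinate z = - x / y *)

Section FormalGroup.

Variables (R : idomainType) (pi b1 b2 b3 b4 b6 : R).
Hypothesis unit1D : forall x, 1 + pi * x \is a GRing.unit.

Local Notation a1 := (pi * b1).
Local Notation a2 := (pi * b2).
Local Notation a3 := (pi * b3).
Local Notation a4 := (pi * b4).
Local Notation a6 := (pi * b6).

Definition zw_cubic (z w : R) :=
  z ^+ 3 + a1 * z * w + a2 * z ^+ 2 * w + a3 * w ^+ 2 + a4 * z * w ^+ 2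
  + a6 * w ^+ 3.

Variable w : R -> R.
Hypothesis wE : forall z, w z = zw_cubic z (w z).

(* The slope of the line through two points is [slope_num / slope_den], also when
   the points coincide; see [zw_cubicB]. *)
Definition slope_num z1 z2 w1 : R :=
  z1 ^+ 2 + z1 * z2 + z2 ^+ 2 + a1 * w1 + a2 * (z1 + z2) * w1 + a4 * w1 ^+ 2.

Definition slope_den z2 w1 w2 : R :=
  1 + pi * - (b1 * z2 + b2 * z2 ^+ 2 + b3 * (w1 + w2) + b4 * z2 * (w1 + w2)
              + b6 * (w1 ^+ 2 + w1 * w2 + w2 ^+ 2)).

(** Splitting the difference into a w-part and a z-part yields the integral slope. At [z1 = z2] it
    also gives the uniqueness of [w] and the contraction that proves its existence. *)
Lemma zw_cubicB z1 z2 w1 w2 :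
  (w1 - zw_cubic z1 w1) - (w2 - zw_cubic z2 w2) =
  (w1 - w2) * slope_den z2 w1 w2 - (z1 - z2) * slope_num z1 z2 w1.
Proof. by rewrite /zw_cubic /slope_den /slope_num; ring. Qed.

Lemma w_unique z v : v = zw_cubic z v -> v = w z.
Proof.
move=> vE; apply/eqP; rewrite -subr_eq0.
rewrite -(mulIr_eq0 (v - w z) (mulIr (unit1D _ : slope_den z v (w z) \is a GRing.unit))).
apply/eqP; have := zw_cubicB z z v (w z).
by rewrite -vE -wE !subrr mul0r subr0 => <-.
Qed.

Lemma w0 : w 0 = 0.
Proof. by apply/esym/w_unique; rewrite /zw_cubic; ring. Qed.

Lemma w_eq0 z : w z = 0 -> z = 0.
Proof.
move=> wz0; have := wE z; rewrite wz0 /zw_cubic => h.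
have /eqP : z ^+ 3 = 0 by rewrite [RHS]h; ring.
by rewrite expf_eq0 => /eqP.
Qed.

Definition slope z1 z2 :=
  slope_num z1 z2 (w z1) / slope_den z2 (w z1) (w z2).

Lemma slope_eqP z1 z2 l :
  l * slope_den z2 (w z1) (w z2) = slope_num z1 z2 (w z1) -> l = slope z1 z2.
Proof. by rewrite /slope => <-; rewrite mulrK ?unit1D. Qed.

Lemma slopeE z1 z2 :
  slope z1 z2 * slope_den z2 (w z1) (w z2) = slope_num z1 z2 (w z1).
Proof. by rewrite divrK ?unit1D. Qed.

Lemma wB z1 z2 : w z1 - w z2 = slope z1 z2 * (z1 - z2).
Proof.
apply: (mulIr (unit1D _ : slope_den z2 (w z1) (w z2) \is a GRing.unit)).
rewrite mulrAC slopeE; apply/eqP; rewrite eq_sym mulrC -subr_eq0 -oppr_eq0 opprB.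
by rewrite -zw_cubicB -!wE !subrr.
Qed.

(* Coefficients, from the leading one down, of the cubic in [z] that cuts out
   the points of the curve on the line [w = l z + n]. *)
Definition line3 l : R := 1 + pi * (b2 * l + b4 * l ^+ 2 + b6 * l ^+ 3).
Definition line2 l n : R :=
  a1 * l + a2 * n + a3 * l ^+ 2 + 2 * a4 * l * n + 3 * a6 * l ^+ 2 * n.
Definition line1 l n : R :=
  a1 * n + 2 * a3 * l * n + a4 * n ^+ 2 + 3 * a6 * l * n ^+ 2 - l.
Definition line0 n : R := a3 * n ^+ 2 + a6 * n ^+ 3 - n.

Lemma lineE l n z : zw_cubic z (l * z + n) - (l * z + n) =
  line3 l * z ^+ 3 + line2 l n * z ^+ 2 + line1 l n * z + line0 n.
Proof. by rewrite /zw_cubic /line3 /line2 /line1 /line0; ring. Qed.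

(* [z1], [z2], [z3] are, with multiplicities, the three points of the curve on the
   line [w = l z + n]: Vieta's formulas. *)
Definition on_line l n z1 z2 z3 :=
  [/\ w z1 = l * z1 + n, w z2 = l * z2 + n & w z3 = l * z3 + n] /\
  [/\ line2 l n = - line3 l * (z1 + z2 + z3),
      line1 l n = line3 l * (z1 * z2 + z1 * z3 + z2 * z3)
    & line0 n = - line3 l * (z1 * z2 * z3)].

(* The third intersection point of the line through [z1] and [z2]. The neutral
   element being the flex [z = 0], the opposite of [z] is [star z 0]. *)
Definition star z1 z2 :=
  let l := slope z1 z2 in
  - (z1 + z2) - line2 l (w z1 - l * z1) / line3 l.

Lemma star_on_line z1 z2 : let l := slope z1 z2 in
  on_line l (w z1 - l * z1) z1 z2 (star z1 z2).
Proof.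
move=> l; rewrite /star -/l; set n := w z1 - _.
have w1 : w z1 = l * z1 + n by rewrite /n; ring.
have w2 : w z2 = l * z2 + n.
  by have := wB z1 z2; rewrite -/l => h; apply: (eq_lincomb (k := -1) h); rewrite w1; ring.
have h1 := lineE l n z1; rewrite -w1 -wE subrr in h1.
have h2 := slopeE z1 z2; rewrite -/l w1 w2 in h2.
set z3 := - (z1 + z2) - _.
have L2 : line2 l n = - line3 l * (z1 + z2 + z3).
  rewrite /z3 -[LHS](divrK (unit1D _ : line3 l \is a GRing.unit)); ring.
have L1 : line1 l n = line3 l * (z1 * z2 + z1 * z3 + z2 * z3).
  (* The divided difference at [z1], [z2] of the cubic on the line. It comes from [slopeE], so it
     remains valid for a tangent. *)
  have h : line3 l * (z1 ^+ 2 + z1 * z2 + z2 ^+ 2) + line2 l n * (z1 + z2) +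
      line1 l n = 0.
    apply: (eq_lincomb (k := -1) h2).
    by rewrite /slope_den /slope_num /line3 /line2 /line1; ring.
  by apply: (eq_lincomb (k := 1) h); rewrite L2; ring.
have L0 : line0 n = - line3 l * (z1 * z2 * z3).
  by apply: (eq_lincomb (k := -1) h1); rewrite L2 L1; ring.
split; split=> //; apply/esym/w_unique/esym/eqP.
by rewrite -subr_eq0 lineE L2 L1 L0; apply/eqP; ring.
Qed.

Lemma on_line_slope l n z1 z2 z3 : on_line l n z1 z2 z3 -> l = slope z1 z2.
Proof.
case=> [[w1 w2 w3] [L2 L1 L0]]; apply: slope_eqP; rewrite w1 w2.
have h : line3 l * (z1 ^+ 2 + z1 * z2 + z2 ^+ 2) + line2 l n * (z1 + z2) +
      line1 l n = 0 by rewrite L2 L1; ring.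
apply: (eq_lincomb (k := -1) h).
by rewrite /slope_den /slope_num /line3 /line2 /line1; ring.
Qed.

(** The first two points determine the line, even when they coincide. Since [on_line] is symmetric
    in its points, this yields commutativity and [starK]. *)
Lemma on_line_star l n z1 z2 z3 : on_line l n z1 z2 z3 -> z3 = star z1 z2.
Proof.
move=> h; have := on_line_slope h.
case: h => [[w1 w2 w3] [L2 L1 L0]]; rewrite /star => <-.
have -> : w z1 - l * z1 = n by rewrite w1; ring.
rewrite L2 !mulNr mulrAC divrr ?unit1D // mul1r; ring.
Qed.

Lemma on_lineC l n z1 z2 z3 : on_line l n z1 z2 z3 -> on_line l n z2 z1 z3.
Proof.
case=> [[w1 w2 w3] [L2 L1 L0]]; do 2![split=> //]; first by rewrite L2; ring.
  by rewrite L1; ring.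
by rewrite L0; ring.
Qed.

Lemma on_line_rot l n z1 z2 z3 : on_line l n z1 z2 z3 -> on_line l n z2 z3 z1.
Proof.
case=> [[w1 w2 w3] [L2 L1 L0]]; do 2![split=> //]; first by rewrite L2; ring.
  by rewrite L1; ring.
by rewrite L0; ring.
Qed.

Lemma starC z1 z2 : star z1 z2 = star z2 z1.
Proof. exact: on_line_star (on_lineC (star_on_line z1 z2)). Qed.

Lemma starK z1 z2 : star z1 (star z1 z2) = z2.
Proof.
rewrite starC; apply/esym.
exact: on_line_star (on_line_rot (on_line_rot (star_on_line z1 z2))).
Qed.

Lemma star00 : star 0 0 = 0.
Proof.
have l0 : slope 0 0 = 0.
  by apply/esym/slope_eqP; rewrite w0 /slope_num; ring.
by rewrite /star l0 w0 /line2 /line3; ring.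
Qed.

Definition zneg z := star z 0.
Definition zadd z1 z2 := zneg (star z1 z2).

Lemma znegK : involutive zneg.
Proof. by move=> z; rewrite /zneg starC [star z 0]starC starK. Qed.

Lemma zaddC : commutative zadd.
Proof. by move=> z1 z2; rewrite /zadd starC. Qed.

Lemma zadd0 : left_id 0 zadd.
Proof. by move=> z; rewrite /zadd starC -/(zneg z) znegK. Qed.

Lemma zaddN : left_inverse 0 zneg zadd.
Proof. by move=> z; rewrite /zadd starC starK /zneg star00. Qed.

Lemma zadd_eqP z1 z2 z3 : zadd z1 z2 = z3 -> z2 = star z1 (zneg z3).
Proof. by move=> <-; rewrite znegK starK. Qed.

Lemma zneg_eq0 z : zneg z = 0 -> z = 0.
Proof. by move=> h; rewrite -[z]znegK h /zneg star00. Qed.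

(** The line through [z] and the neutral point has intercept 0, so Vieta's formulas give the sum and
    the product of the other two roots; eliminating [line3 l] relates them. For nonzero [z], [l] is
    the inverse of the common x-coordinate of the two points. *)
Lemma znegE z : exists l, [/\ w z = l * z, w (zneg z) = l * zneg z
  & z + zneg z = z * zneg z * (a1 + a3 * l)].
Proof.
have [[w1 w2 w3] [L2 L1 L0]] := star_on_line z 0.
move: w1 w2 w3 L2 L1 L0; set l := slope z 0; set n := w z - _ => w1 w2 w3 L2 L1 L0.
exists l; have n0 : n = 0 by move: w2; rewrite w0 mulr0 add0r.
rewrite -/(zneg z) in w3 L2 L1 *.
rewrite w1 w3 n0 !addr0; split=> //.
apply: (mulrI (unit1D _ : line3 l \is a GRing.unit)).
have e2 : line2 l n = l * (a1 + a3 * l) by rewrite /line2 n0; ring.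
have e1 : line1 l n = - l by rewrite /line1 n0; ring.
rewrite e2 in L2; rewrite e1 in L1.
apply: (@etrans _ _ (- l * (a1 + a3 * l))).
  by apply: (eq_lincomb (k := 1) L2); ring.
by apply: (eq_lincomb (k := a1 + a3 * l) L1); ring.
Qed.

Lemma w_congr d z z' : cong d z z' -> cong d (w z) (w z').
Proof. by case=> c h; exists (slope z z' * c); rewrite wB h; ring. Qed.

Lemma star_congr d z1 z1' z2 z2' : cong d z1 z1' -> cong d z2 z2' ->
  cong d (star z1 z2) (star z1' z2').
Proof.
move=> c1 c2; have cw1 := w_congr c1; have cw2 := w_congr c2.
have cs : cong d (slope z1 z2) (slope z1' z2').
  apply: congM; last apply: congV; rewrite ?unit1D //;
  rewrite /slope_num /slope_den; do ![apply: cong_refl | by [] | apply: congD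
    | apply: congN | apply: congM | apply: congX].
rewrite /star; apply: congD; first by apply/congN/congD.
apply/congN/congM; last apply: congV; rewrite ?unit1D //;
  rewrite /line2 /line3; do ![apply: cong_refl | by [] | apply: congD
    | apply: congN | apply: congM | apply: congX].
Qed.

Lemma zadd_congr d z1 z1' z2 z2' : cong d z1 z1' -> cong d z2 z2' ->
  cong d (zadd z1 z2) (zadd z1' z2').
Proof. by move=> h1 h2; do !apply: star_congr => //; apply: cong_refl. Qed.

(* The factor [z1 z2] comes from the intercept [n] of the line, which is a multiple
   of it by the formula for the product of the three roots. *)
Lemma zaddE z1 z2 : exists u, zadd z1 z2 = z1 + z2 + pi * z1 * z2 * u.
Proof.
have [[w1 w2 w3] [L2 L1 L0]] := star_on_line z1 z2.
move: w1 w2 w3 L2 L1 L0; set l := slope z1 z2; set n := w z1 - _ => w1 w2 w3.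
have [m [wt _ rt]] := znegE (star z1 z2).
rewrite -/(zadd z1 z2) in rt; move: w3 wt rt.
set t := star z1 z2; set r := zadd z1 z2 => w3 wt rt L2 L1 L0.
(* [U] and [D] are the units to divide by: the product of the roots gives
   [n * U = line3 l * z1 * z2 * t], and [znegE] gives [r * D = - t]. *)
have uU := unit1D (- (b3 * n + b6 * n ^+ 2)); set U := 1 + _ in uU.
have uD := unit1D (- (b1 * t + b3 * w t)); set D := 1 + _ in uD.
set k := line3 l * t / U.
have nE : n = z1 * z2 * k.
  rewrite /k; apply: (mulIr uU); rewrite mulrA divrK //.
  by apply: (eq_lincomb (k := -1) L0); rewrite /line0 /U; ring.
have rD : r * D = - t.
  by apply: (eq_lincomb (k := 1) rt); rewrite /D wt; ring.
pose X := k * (b2 + 2 * b4 * l + 3 * b6 * l ^+ 2)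
  + (b1 + b3 * l) * (k * (a1 + 2 * a3 * l + a4 * n + 3 * a6 * l * n) - line3 l)
  + line3 l * (z1 + z2) * b3 * k.
have u3 : line3 l \is a GRing.unit by apply: unit1D.
have key : line3 l * D * (r - (z1 + z2)) = pi * z1 * z2 * X.
  (* Every term of [c] carries [pi], and [n] carries [z1 * z2]; in the remaining term [pi] comes
     from [a1] and [a3]. *)
  pose c := a2 + 2 * a4 * l + 3 * a6 * l ^+ 2
    + (a1 + a3 * l) * (a1 + 2 * a3 * l + a4 * n + 3 * a6 * l * n)
    + line3 l * (z1 + z2) * a3.
  apply: (@etrans _ _ (n * c - (a1 + a3 * l) * line3 l * (z1 * z2))); last first.
    by apply: (eq_lincomb (k := c) nE); rewrite /X /c; ring.
  apply: (@etrans _ _ (- line3 l * (t + (z1 + z2) * D))).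
    by apply: (eq_lincomb (k := line3 l) rD); ring.
  apply: (@etrans _ _ (line2 l n + line3 l * (z1 + z2) * ((a1 + a3 * l) * t + a3 * n))).
    by apply: (eq_lincomb (k := -1) L2); rewrite /D w3; ring.
  apply: (eq_lincomb (k := - (a1 + a3 * l)) L1).
  by rewrite /c /line2 /line1; ring.
exists (X / (line3 l * D)).
rewrite mulrA -key mulrAC divrr ?mul1r; first by ring.
by rewrite unitrM unit1D.
Qed.

(** The coefficient of [pi] in the group law. Here [l] and [n] are the slope and the intercept for
    the reduced curve w = z^3, whose group law is ordinary addition. *)
Definition add_defect z1 z2 :=
  let s := z1 + z2 in let l := s ^+ 2 - z1 * z2 in let n := - (z1 * z2 * s) in
  b1 * (l - s ^+ 2) + b2 * n + b3 * (l ^+ 2 - s ^+ 4) + 2 * b4 * l * n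
  + 3 * b6 * l ^+ 2 * n.

Lemma add_defect_congr d z1 z2 z2' :
  cong d z2 z2' -> cong d (add_defect z1 z2) (add_defect z1 z2').
Proof.
move=> h; rewrite /add_defect; do ![exact: h | apply: cong_refl | apply: congD
  | apply: congN | apply: congM | apply: congX].
Qed.

(** The integer sums are parameters so that they can be replaced by their residues 0 or -1 modulo
    p. *)
Definition mul_defect_form z s2 s3 s4 s5 s7 : R :=
  - (b1 * z ^+ 2 * s2 + b2 * z ^+ 3 * s3 + b3 * z ^+ 4 * s4
    + 2 * b4 * z ^+ 5 * s5 + 3 * b6 * z ^+ 7 * s7).

Lemma mul_defect_form_congr d z s2 s3 s4 s5 s7 s2' s3' s4' s5' s7' :
  cong d s2 s2' -> cong d s3 s3' -> cong d s4 s4' -> cong d s5 s5' ->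
  cong d s7 s7' -> cong d (mul_defect_form z s2 s3 s4 s5 s7)
                          (mul_defect_form z s2' s3' s4' s5' s7').
Proof.
by move=> *; do ![assumption | exact: cong_refl | apply: congN | apply: congD
  | apply: congM].
Qed.

Lemma congMpi y y' : cong pi y y' -> cong (pi ^+ 2) (pi * y) (pi * y').
Proof. by case=> c h; exists c; rewrite expr2 -mulrA -h; ring. Qed.

(** Once the correction to [z1 + z2] is written with an explicit factor [pi], its ingredients matter
    only modulo [pi], where they can be read off from w = z^3. *)
Lemma zadd_mod2 z1 z2 :
  cong (pi ^+ 2) (zadd z1 z2) (z1 + z2 + pi * add_defect z1 z2).
Proof.
set s := z1 + z2; set l0 := s ^+ 2 - z1 * z2; set n0 := - (z1 * z2 * s).
have [[w1 w2 w3] [L2 L1 L0]] := star_on_line z1 z2.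
have slope_l := slopeE z1 z2.
move: slope_l w1 w2 w3 L2 L1 L0; set l := slope z1 z2; set n := w z1 - _.
move=> slope_l w1 w2 w3; have [m [wt _ rt]] := znegE (star z1 z2).
rewrite -/(zadd z1 z2) in rt; move: w3 wt rt.
set t := star z1 z2; set r := zadd z1 z2 => w3 wt rt L2 L1 L0.
have wpi z : cong pi (w z) (z ^+ 3).
  exists (b1 * z * w z + b2 * z ^+ 2 * w z + b3 * w z ^+ 2
    + b4 * z * w z ^+ 2 + b6 * w z ^+ 3).
  by rewrite [w z in LHS]wE /zw_cubic; ring.
have cl : cong pi l l0.
  exists (b1 * w z1 + b2 * (z1 + z2) * w z1 + b4 * w z1 ^+ 2
    + l * (b1 * z2 + b2 * z2 ^+ 2 + b3 * (w z1 + w z2) + b4 * z2 * (w z1 + w z2)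
           + b6 * (w z1 ^+ 2 + w z1 * w z2 + w z2 ^+ 2))).
  apply: (eq_lincomb (k := 1) slope_l).
  by rewrite /l0 /s /slope_num /slope_den; ring.
have cn : cong pi n n0.
  have -> : n0 = z1 ^+ 3 - l0 * z1 by rewrite /n0 /l0 /s; ring.
  apply: congD (wpi _) (congN _); apply: congM cl (cong_refl _ _).
pose be := b1 * l + b2 * n + b3 * l ^+ 2 + 2 * b4 * l * n + 3 * b6 * l ^+ 2 * n.
pose al := b2 * l + b4 * l ^+ 2 + b6 * l ^+ 3.
have ct : cong pi t (- s).
  exists (- be - al * (s + t)).
  apply: (eq_lincomb (k := 1) L2).
  by rewrite /line2 /line3 /be /al -/s; ring.
have cw : cong pi (w t) ((- s) ^+ 3) := cong_trans (wpi t) (congX 3 ct).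
have rt' : r = - t + pi * (r * (b1 * t + b3 * w t)).
  by apply: (eq_lincomb (k := 1) rt); rewrite wt; ring.
have cr : cong pi r s.
  apply: cong_trans (_ : cong pi (- t) s); last first.
    by rewrite -[s]opprK; apply: congN.
  by exists (r * (b1 * t + b3 * w t)); rewrite {1}rt' addrC addKr.
have -> : r = s + pi * (be + al * (s + t) + r * (b1 * t + b3 * w t)).
  rewrite {1}rt'; apply: (eq_lincomb (k := -1) L2).
  by rewrite /line2 /line3 /be /al -/s; ring.
(* The zero term [al * (s + - s)] is kept to match [al * (s + t)] termwise: the third point [t] is
   congruent to [- s]. *)
have -> : add_defect z1 z2 = b1 * l0 + b2 * n0 + b3 * l0 ^+ 2 + 2 * b4 * l0 * n0
      + 3 * b6 * l0 ^+ 2 * n0 + al * (s + - s)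
      + s * (b1 * - s + b3 * (- s) ^+ 3).
  by rewrite /add_defect -/s -/l0 -/n0; ring.
apply: congD (cong_refl _ _) _.
apply: congMpi; do ![assumption | exact: cong_refl | apply: congD | apply: congN
  | apply: congM | apply: congX].
Qed.

(** * Comparison with the group law of the curve over a field *)

Variables (K : fieldType) (f : {rmorphism R -> K}).
Hypothesis injf : injective f.

Local Notation EK := (map_weierstrass f (Weierstrass a1 a2 a3 a4 a6)).

Definition psi (z : R) : point K :=
  if z == 0 then Infinity else Affine (f z / f (w z)) (- (f (w z))^-1).

Lemma f_eq0 x : f x = 0 -> x = 0.
Proof. by move=> h; apply: injf; rewrite rmorph0. Qed.

Lemma fw_neq0 z : z != 0 -> f (w z) != 0.
Proof. by apply: contraNneq => /f_eq0/w_eq0->. Qed.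

Lemma psi0 : psi 0 = Infinity.
Proof. by rewrite /psi eqxx. Qed.

Lemma psiE z : z != 0 -> psi z = Affine (f z / f (w z)) (- (f (w z))^-1).
Proof. by rewrite /psi => /negPf ->. Qed.

Lemma psi_inj : injective psi.
Proof.
move=> z1 z2; rewrite /psi.
have [->|z10] := eqVneq z1 0; have [->|z20] := eqVneq z2 0 => //.
case=> + /oppr_inj/invr_inj wz; rewrite wz => /(congr1 (fun x => x * f (w z2))).
by rewrite !divfK ?fw_neq0 // => /injf.
Qed.

Lemma psi_on_curve z : on_curve EK (psi z).
Proof.
have [->|z0] := eqVneq z 0; first by rewrite psi0.
rewrite psiE //=; have W0 := fw_neq0 z0; apply/eqP.
apply: (mulIf (expf_neq0 3 W0)).
apply: (eq_lincomb (k := 1) (congr1 f (wE z))); rewrite /zw_cubic.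
by field.
Qed.

Lemma psi_add z1 z2 : add_point EK (psi z1) (psi z2) = psi (zadd z1 z2).
Proof.
have [->|z10] := eqVneq z1 0; first by rewrite psi0 zadd0.
have [->|z20] := eqVneq z2 0.
  by rewrite psi0 zaddC // zadd0 //; case: (psi z1).
have W1 := fw_neq0 z10; have W2 := fw_neq0 z20.
have slope_l := slopeE z1 z2; have := star_on_line z1 z2.
move: slope_l; rewrite /=; set l := slope z1 z2.
set n := w z1 - _; set t := star z1 z2 => slope_l.
case=> [[w1 w2 w3] [L2 L1 L0]].
have u3 : line3 l != 0.
  by apply/eqP => h; have := unit1D (b2 * l + b4 * l ^+ 2 + b6 * l ^+ 3);
  rewrite -/(line3 _) h unitr0.
(* A zero intercept means that the line passes through [z = 0]: the product of the roots forces
   [t = 0], and the two points are opposite. Otherwise w = l z + n becomes y = (l / n) x - 1 / n. *)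
have [n0|n0] := eqVneq n 0.
  have t0 : t = 0.
    move: L0 => /eqP; rewrite n0 /line0 !expr0n /= !mulr0 subr0 addr0 eq_sym.
    by rewrite mulNr oppr_eq0 !mulf_eq0 (negPf u3) (negPf z10) (negPf z20) => /eqP.
  rewrite /zadd -/t t0 /zneg star00 psi0 !psiE //.
  rewrite n0 addr0 in w1; rewrite n0 addr0 in w2.
  have l0 : l != 0 by apply: contraNneq z10 => l0; apply/eqP/w_eq0; rewrite w1 l0 mul0r.
  have fl0 : f l != 0 by apply: contraNneq l0 => /f_eq0 ->.
  have fz1 : f z1 != 0 by apply: contraNneq z10 => /f_eq0 ->.
  have fz2 : f z2 != 0 by apply: contraNneq z20 => /f_eq0 ->.
  have xE z : f z != 0 -> f z / f (l * z) = (f l)^-1 by move=> ?; field; apply/andP.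
  have e12 : z1 + z2 = z1 * z2 * (a1 + a3 * l).
    apply: (mulfI u3).
    apply: (eq_lincomb2 (k := 1) (l := a1 + a3 * l) L2 L1).
    by rewrite t0 n0 /line2 /line1; ring.
  rewrite /= w1 w2 !xE // eqxx /= ifT //; apply/eqP.
  apply: (mulfI fz1); apply: (mulfI fz2); apply: (mulfI fl0).
  apply: (eq_lincomb (k := -1) (congr1 f e12)).
  by field; apply/and3P.
have fn0 : f n != 0 by apply: contraNneq n0 => /f_eq0 ->.
have t0 : t != 0.
  apply: contraNneq n0 => t0; move: L0; rewrite t0 !mulr0 => h.
  apply/eqP/(mulIr (unit1D (- (b3 * n + b6 * n ^+ 2)))).
  by apply: (eq_lincomb (k := -1) h); rewrite /line0; ring.
have Wt := fw_neq0 t0.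
have [m [wt wr rt]] := znegE t.
have r0 : zneg t != 0 by apply: contraNneq t0 => /zneg_eq0 ->.
have Wr := fw_neq0 r0.
have fm0 : f m != 0.
  by apply: contraNneq Wt => /f_eq0 m0; rewrite wt m0 mul0r rmorph0.
have nY z : f (w z) != 0 -> w z = l * z + n ->
    - (f (w z))^-1 = f l / f n * (f z / f (w z)) - (f n)^-1.
  move=> fw0 wz; apply: (mulIf fw0); apply: (mulIf fn0).
  apply: (eq_lincomb (k := 1) (congr1 f wz)).
  by field; rewrite fn0.
have -> : add_point EK (psi z1) (psi z2) =
   chord EK (f l / f n) (f z1 / f (w z1)) (- (f (w z1))^-1) (f z2 / f (w z2)).
  rewrite !psiE //; have [z12|z12] := eqVneq z1 z2.
    (* The denominator 2y + a1 x + a3 of the tangent slope is thus [n] times a unit, up to a power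
       of [w z1]; so it does not vanish. *)
    have nden : n * slope_den z1 (w z1) (w z1) = w z1 * (a1 * z1 + a3 * w z1 - 2).
      rewrite -z12 in slope_l.
      apply: (eq_lincomb2 (k := - z1) (l := 3) slope_l (wE z1)).
      by rewrite /n /slope_den /slope_num /zw_cubic; ring.
    have u12 : f (slope_den z1 (w z1) (w z1)) != 0.
      apply: contraTneq (unit1D (- (b1 * z1 + b2 * z1 ^+ 2 + b3 * (w z1 + w z1)
        + b4 * z1 * (w z1 + w z1) + b6 * (w z1 ^+ 2 + w z1 * w z1 + w z1 ^+ 2)))).
      by move=> /f_eq0; rewrite /slope_den => ->; rewrite unitr0.
    have dE : 2 * - (f (w z1))^-1 + f a1 * (f z1 / f (w z1)) + f a3 =
        f n * f (slope_den z1 (w z1) (w z1)) / f (w z1) ^+ 2.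
      rewrite -rmorphM nden; field; exact: W1.
    rewrite -z12; apply: add_tangent; rewrite /= dE.
      by rewrite mulf_neq0 ?invr_neq0 ?expf_neq0 // mulf_neq0.
    rewrite -z12 in slope_l; apply: (mulIf (expf_neq0 2 W1)).
    set d := slope_den _ _ _ in slope_l *.
    rewrite [RHS](_ : _ = f (l * d)); last by field; rewrite W1.
    by rewrite slope_l /slope_num; field.
  apply: add_chord.
    apply: contra_neq z12 => h.
    have {}h : f (z1 * w z2) = f (z2 * w z1).
      apply: (eq_lincomb (k := f (w z1) * f (w z2)) h).
      by rewrite !rmorphM; field; rewrite W1 W2.
    apply: (mulIf n0); apply: (eq_lincomb (k := 1) (injf h)).
    by rewrite w1 w2; ring.
  by rewrite (nY _ W1 w1) (nY _ W2 w2); ring.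
(* [prodW] and [sumZ] are symmetric in the three roots, so Vieta's formulas evaluate them; their
   quotient is the sum of the x-coordinates. *)
have prodW : line3 l * (w z1 * w z2 * w t) = n ^+ 3.
  rewrite w1 w2 w3.
  apply: (@etrans _ _ (n ^+ 3 * line3 l - l * n ^+ 2 * line2 l n
    + l ^+ 2 * n * line1 l n - l ^+ 3 * line0 n)).
    by rewrite L2 L1 L0; ring.
  by rewrite /line3 /line2 /line1 /line0; ring.
have sumZ : line3 l * (z1 * (w z2 * w t) + z2 * (w z1 * w t) + t * (w z1 * w z2))
    = n * (l ^+ 2 + a1 * l * n - a2 * n ^+ 2).
  rewrite w1 w2 w3.
  apply: (@etrans _ _ (- 3 * l ^+ 2 * line0 n + 2 * l * n * line1 l n
    - n ^+ 2 * line2 l n)); first by rewrite L2 L1 L0; ring.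
  by rewrite /line2 /line1 /line0; ring.
have x3E : (f l / f n) ^+ 2 + f a1 * (f l / f n) - f a2 - f z1 / f (w z1)
    - f z2 / f (w z2) = f t / f (w t).
  have fu3 : f (line3 l) != 0 by apply: contraNneq u3 => /f_eq0 ->.
  have : f z1 / f (w z1) + f z2 / f (w z2) + f t / f (w t)
      = f (n * (l ^+ 2 + a1 * l * n - a2 * n ^+ 2)) / f (n ^+ 3).
    by rewrite -prodW -sumZ; field; rewrite W1 W2 Wt fu3.
  move=> h; apply: (eq_lincomb (k := -1) h).
  by field; rewrite ?W1 ?W2 ?Wt ?fn0.
have tm : f t / f (w t) = (f m)^-1.
  rewrite wt; field; rewrite fm0; apply: contraNneq t0 => /f_eq0 ->.
  by [].
have ft0 : f t != 0 by apply: contraNneq t0 => /f_eq0 ->.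
have fr0 : f (zneg t) != 0 by apply: contraNneq r0 => /f_eq0 ->.
have xr : f (zneg t) / f (w (zneg t)) = (f m)^-1.
  by rewrite wr; field; rewrite ?fr0 ?fm0.
rewrite psiE // /chord /= x3E tm /zadd -/t xr; congr Affine.
have := nY t Wt w3; rewrite tm (nY z1 W1 w1) => h.
apply: (@etrans _ _ ((f (w t))^-1 - f a1 / f m - f a3)).
  by apply: (eq_lincomb (k := 1) h); field; rewrite ?fn0 ?Wt ?W1 ?fm0.
rewrite wr wt; apply: (mulfI ft0); apply: (mulfI fr0); apply: (mulfI fm0).
by apply: (eq_lincomb (k := 1) (congr1 f rt)); field; rewrite ?ft0 ?fr0 ?fm0.
Qed.

Lemma zneg0 : zneg 0 = 0.
Proof. exact: star00. Qed.

Lemma opp_psi z : opp_point EK (psi z) = psi (zneg z).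
Proof.
have [->|z0] := eqVneq z 0; first by rewrite zneg0 psi0.
have [l [wz wr zr]] := znegE z.
have r0 : zneg z != 0 by apply: contraNneq z0 => /zneg_eq0 ->.
have fz : f z != 0 by apply: contraNneq z0 => /f_eq0 ->.
have fr : f (zneg z) != 0 by apply: contraNneq r0 => /f_eq0 ->.
have fl : f l != 0.
  by apply: contraNneq (fw_neq0 z0) => /f_eq0 l0; rewrite wz l0 mul0r rmorph0.
rewrite !psiE //= wz wr; congr Affine; first by field; rewrite fl fr.
apply: (mulfI fz); apply: (mulfI fr); apply: (mulfI fl).
by apply: (eq_lincomb (k := 1) (congr1 f zr)); field; rewrite ?fl ?fr ?fz.
Qed.

(** Subtracting the curve equations at equal x leaves a product whose factors say that the points
    are equal or opposite. *)
Lemma psi_x_neq z1 z2 x1 y1 x2 y2 :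
  psi z1 = Affine x1 y1 -> psi z2 = Affine x2 y2 ->
  z1 != z2 -> z2 != zneg z1 -> x1 != x2.
Proof.
move=> P1 P2 z12 z2N; apply/eqP => x12.
have := psi_on_curve z1; have := psi_on_curve z2; have := psi_add z1 z2.
rewrite P1 P2 x12 => PD /eqP C2 /eqP C1.
have /eqP : (y1 - y2) * (y1 + y2 + f a1 * x2 + f a3) = 0.
  by apply: (eq_lincomb2 (k := 1) (l := -1) C1 C2) => /=; ring.
rewrite mulf_eq0 subr_eq0 => /orP[/eqP y12|y0].
  by case/eqP: z12; apply: psi_inj; rewrite P1 P2 x12 y12.
move: PD; rewrite /= eqxx y0 /= -psi0 => /psi_inj/esym/zadd_eqP.
by rewrite zneg0 => z2E; case/eqP: z2N.
Qed.

(** The excluded values are those where a chord used by [chord_assoc] would have two equal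
    x-coordinates. The last two, found by [zadd_eqP], are the [z3] for which [zadd z2 z3] is [z1] or
    [zneg z1]. *)
Lemma zaddA_generic z1 z2 z3 :
  z1 != 0 -> z2 \notin [:: 0; z1; zneg z1] ->
  z3 \notin [:: 0; z2; zneg z2; zadd z1 z2; zneg (zadd z1 z2);
                 star z2 (zneg z1); star z2 (zneg (zneg z1))] ->
  zadd (zadd z1 z2) z3 = zadd z1 (zadd z2 z3).
Proof.
rewrite !inE !negb_or => z10 /and3P[z20 z21 z21N].
case/and5P=> z30 z32 z32N z312 /and3P[z312N z231 z231N].
have z12_0 : zadd z1 z2 != 0.
  by apply: contraNneq z21N => /zadd_eqP ->; rewrite zneg0.
have z23_0 : zadd z2 z3 != 0.
  by apply: contraNneq z32N => /zadd_eqP ->; rewrite zneg0.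
have z23_1 : zadd z2 z3 != z1 by apply: contraNneq z231 => /zadd_eqP ->.
have z23_1N : zadd z2 z3 != zneg z1 by apply: contraNneq z231N => /zadd_eqP ->.
apply: psi_inj; rewrite -!psi_add.
have C1 := psi_on_curve z1; have C2 := psi_on_curve z2.
have C3 := psi_on_curve z3; have A12 := psi_add z1 z2.
have A23 := psi_add z2 z3.
have P1 := psiE z10; have P2 := psiE z20; have P3 := psiE z30.
have P12 := psiE z12_0; have P23 := psiE z23_0.
have X12 := psi_x_neq P1 P2; have X23 := psi_x_neq P2 P3.
have X123 := psi_x_neq P12 P3; have X1 := psi_x_neq P1 P23.
rewrite A12 A23; rewrite P1 P2 P12 in A12; rewrite P2 P3 P23 in A23.
rewrite P1 in C1; rewrite P2 in C2; rewrite P3 in C3; rewrite P12 P1 P3 P23.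
apply: chord_assoc C1 C2 C3 A12 A23 _ _ _ _;
  [apply: X12 | apply: X23 | apply: X123 | apply: X1] => //; by rewrite eq_sym.
Qed.

(** * Associativity by approximation *)

Hypothesis pi_neq0 : pi != 0.
Hypothesis pi_nunit : pi \isn't a GRing.unit.
Hypothesis separated : forall x y, (forall n, cong (pi ^+ n) x y) -> x = y.

(** The elements [z + pi ^+ (n + k)] are pairwise distinct, so [size s + 1] of them cannot all lie
    in [s]. *)
Lemma approx_notin (s : seq R) z n :
  exists2 z', cong (pi ^+ n) z' z & z' \notin s.
Proof.
have powI : injective (fun k => z + pi ^+ (n + k)).
  move=> i j /addrI; wlog ij : i j / (i <= j)%N.
    by move=> h; case/orP: (leq_total i j) => /h // k /esym/k.
  rewrite -(subnKC ij) addnA [pi ^+ (n + i + _)]exprD -[X in X = _]mulr1.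
  move/(mulfI (expf_neq0 _ pi_neq0)); case: (j - i)%N => [|k]; rewrite ?addn0 //.
  by move=> h; case/negP: pi_nunit; rewrite -(unitrX_pos pi (ltn0Sn k)) -h unitr1.
have /allPn[z' /mapP[k _ ->] z's] :
    ~~ all (mem s) [seq z + pi ^+ (n + k) | k <- iota 0 (size s).+1].
  apply/negP => /allP /uniq_leq_size; rewrite map_inj_uniq // iota_uniq.
  by rewrite size_map size_iota ltnn => /(_ isT).
exists (z + pi ^+ (n + k)) => //.
by exists (pi ^+ k); rewrite exprD addrC addKr.
Qed.

(* [zadd] is continuous and the triples in general position are dense. *)
Lemma zaddA : associative zadd.
Proof.
move=> z1 z2 z3; apply: separated => n.
have [y1 c1] := approx_notin [:: 0] z1 n; rewrite inE => y10.
have [y2 c2 y2s] := approx_notin [:: 0; y1; zneg y1] z2 n.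
have [y3 c3 y3s] := approx_notin [:: 0; y2; zneg y2; zadd y1 y2;
  zneg (zadd y1 y2); star y2 (zneg y1); star y2 (zneg (zneg y1))] z3 n.
apply: cong_trans (_ : cong _ (zadd y1 (zadd y2 y3)) _).
  by do ![apply: zadd_congr | exact: cong_sym].
rewrite -zaddA_generic //; by do ![apply: zadd_congr | done].
Qed.

End FormalGroup.

(** * p-adic integers *)

Section PadicFacts.

Variables (p : nat) (p_pr : prime p).
Local Notation Zp := (padic_int p_pr).
Local Notation q n := (p%:Z ^+ n).
Implicit Types x y z : Zp.

Lemma expz_nat n : q n = (p ^ n)%N :> int.
Proof. by elim: n => [|n IHn]; rewrite ?expr0 ?exprS ?expnS ?PoszM ?IHn. Qed.

Lemma expz_neq0 n : q n != 0.
Proof. by rewrite expf_neq0 // eqz_nat -lt0n prime_gt0. Qed.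

Lemma residue_nat (m n : nat) : (m%:R : Zp) n = (m%:Z %% q n)%Z.
Proof.
elim: m => [|m IHm]; first by [].
by rewrite -natr1 /= IHm modzDm -PoszD addn1.
Qed.

Lemma residue_lt x n : exists2 m : nat, x n = m & (m < p ^ n)%N.
Proof.
have q0 : 0 < q n by rewrite expz_nat ltz_nat expn_gt0 prime_gt0.
have := ltz_pmod (x n) q0; have := modz_ge0 (x n) (lt0r_neq0 q0).
rewrite residue_mod; case: (x n) => // m _; rewrite expz_nat ltz_nat.
by exists m.
Qed.

Lemma residue_dvd x n : x n = 0 -> exists c, x = p%:R ^+ n * c.
Proof.
move=> xn0.
have dv k : (q n %| x (n + k)%N)%Z.
  by apply/dvdz_mod0P; rewrite residue_exp.
pose u k := (x (n + k)%N %/ q n)%Z.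
have uE k : u k * q n = x (n + k)%N by rewrite divzK.
have uc k : (u k = u k.+1 %[mod q k])%Z.
  apply/eqP; rewrite eqz_mod_dvd -(dvdz_mul2r (expz_neq0 n)) mulrBl !uE -exprD.
  rewrite addnS -eqz_mod_dvd [(k + n)%N]addnC [x (n + k)%N]residueS.
  by rewrite modz_mod.
exists (padic_seq p_pr uc); apply/padic_eqP => k; rewrite -natrX /=.
rewrite residue_nat -expz_nat !modz_mod modzMm mulrC uE addnC -(residue_exp x k n).
by rewrite modz_mod.
Qed.

Lemma congP x y n : cong (p%:R ^+ n) x y <-> x n = y n.
Proof.
split=> [[c xy]|xy].
  have -> : x = y + p%:R ^+ n * c by rewrite -xy addrC subrK.
  by rewrite -natrX /= residue_nat -expz_nat modzz mul0r mod0z addr0 residue_mod.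
by apply: residue_dvd; rewrite /= modzDmr xy subrr mod0z.
Qed.

Lemma separated x y : (forall n, cong (p%:R ^+ n) x y) -> x = y.
Proof. by move=> h; apply: padic_eqP => n; have /congP -> := h n. Qed.

Lemma padic_lim (u : nat -> Zp) : (forall n, cong (p%:R ^+ n) (u n) (u n.+1)) ->
  exists l, forall n, cong (p%:R ^+ n) l (u n).
Proof.
move=> uc; have uc' n : (u n n = u n.+1 n.+1 %[mod q n])%Z.
  by have /congP -> := uc n; rewrite -addn1 residue_exp residue_mod.
by exists (padic_seq p_pr uc') => n; apply/congP; rewrite /= residue_mod.
Qed.

Lemma cong_nat x n : exists m : nat, cong (p%:R ^+ n) x m%:R.
Proof.
have [m xm _] := residue_lt x n; exists m; apply/congP.
by rewrite residue_nat -xm residue_mod.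
Qed.

Lemma one_mod_p_neq0 : 1%:Z != 0 %[mod q 1]%Z.
Proof.
rewrite eqz_mod_dvd subr0 expr1 dvdz1 /=; apply/negP => /eqP p1.
by have := prime_gt1 p_pr; rewrite p1.
Qed.

Lemma residue0 n : (0 : Zp) n = 0.
Proof. by rewrite (residue_nat 0) mod0z. Qed.

(** If [x] is nonzero modulo p, each [x n] is invertible modulo p^n; uniqueness of inverses makes
    these inverses coherent. *)
Lemma unit_residue1 x : (x \is a GRing.unit) = (x 1%N != 0).
Proof.
apply/idP/idP => [ux|x1].
  apply/negP => /eqP x1; have := congr1 (fun y : Zp => y 1%N) (mulrV ux).
  by rewrite /= x1 mul0r mod0z => h; case/negP: one_mod_p_neq0; rewrite -h mod0z.
have co n : coprimez (x n) (q n).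
  case: n => [|n]; first by rewrite expr0 coprimezE coprimen1.
  apply: coprimezXr; rewrite coprimez_sym coprimezE prime_coprime //.
  apply: contra x1 => /dvdz_mod0P; rewrite -[p%:Z]expr1 => h.
  by rewrite -(residue_exp x 1 n) add1n h.
have inv n : exists v : int, (v * x n = 1 %[mod q n])%Z.
  have /coprimezP[[u v] /= uv] := co n; exists u.
  by apply/eqP; rewrite eqz_mod_dvd -uv opprD addNKr -mulNr dvdz_mull.
have [v vE] := choice inv.
have vc n : (v n = v n.+1 %[mod q n])%Z.
  apply/eqP; rewrite eqz_mod_dvd -(Gauss_dvdzl _ (_ : coprimez _ (x n))); last first.
    by rewrite coprimez_sym.
  rewrite mulrBl -eqz_mod_dvd vE residueS modzMmr eq_sym.
  by rewrite -(modz_exp p (v n.+1 * x n.+1) n 1) addn1 vE -addn1 modz_exp.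
apply/unitrPr; exists (padic_seq p_pr vc); apply/padic_eqP => n.
by rewrite /= modzMmr mulrC vE.
Qed.

Lemma unit_nat (m : nat) : ((m%:R : Zp) \is a GRing.unit) = ~~ (p %| m)%N.
Proof.
rewrite unit_residue1 residue_nat expr1; congr negb.
by apply/eqP/idP => [/dvdz_mod0P|h]; last apply/dvdz_mod0P.
Qed.

Lemma p_nunit : (p%:R : Zp) \isn't a GRing.unit.
Proof. by rewrite unit_nat dvdnn. Qed.

Lemma p_neq0 : (p%:R : Zp) != 0.
Proof.
apply/eqP => /(congr1 (fun x : Zp => x 2)); rewrite residue_nat residue0.
move=> /dvdz_mod0P; rewrite expz_nat => /dvdn_leq; rewrite prime_gt0 // => /(_ isT).
by rewrite /= leqNgt -{1}(expn1 p) ltn_exp2l ?prime_gt1.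
Qed.

Lemma nunitP x : x \isn't a GRing.unit -> exists c, x = p%:R * c.
Proof.
rewrite unit_residue1 negbK => /eqP /residue_dvd[c]; rewrite expr1 => ->.
by exists c.
Qed.

Lemma nunit_pM x : p%:R * x \isn't a GRing.unit.
Proof. by rewrite unitrM (negPf p_nunit). Qed.

Lemma unit1D x : 1 + p%:R * x \is a GRing.unit.
Proof.
apply: contraT => /nunitP[c h]; have := nunit_pM (c - x).
by rewrite mulrBr -h addrK unitr1.
Qed.

Lemma padic_val x : x != 0 -> exists n u, u \is a GRing.unit /\ x = p%:R ^+ n * u.
Proof.
move=> x0; have [n xn] : exists n, x n != 0.
  apply: contrapT => h; case/eqP: x0; apply: separated => n; apply/congP.
  by rewrite residue0; apply: contrapT => /eqP xn; apply: h; exists n.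
elim: n x x0 xn => [|n IHn] x x0 xn.
  by case/eqP: xn; rewrite -residue_mod expr0 modz1.
have [ux|/nunitP[c xE]] := boolP (x \is a GRing.unit).
  by exists 0%N, x; rewrite expr0 mul1r.
have c0 : c != 0 by apply: contraNneq x0 => c0; rewrite xE c0 mulr0.
have cn : c n != 0.
  apply: contraNneq xn => cn; have [d cE] : cong (p%:R ^+ n) c 0.
    by apply/congP; rewrite residue0.
  rewrite -(residue0 n.+1); apply/eqP/congP; exists d.
  by rewrite xE exprS -mulrA -cE !subr0.
have [k [u [uu cE]]] := IHn c c0 cn.
by exists k.+1, u; rewrite xE cE exprS mulrA.
Qed.

Lemma red_eq0 x : (padic_red x == 0) = (x \isn't a GRing.unit).
Proof.
rewrite unit_residue1 negbK /padic_red; have [m -> mp] := residue_lt x 1.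
rewrite expn1 in mp; rewrite -pmulrn -(dvdn_pcharf (pchar_Fp p_pr)) eqz_nat.
by case: m mp => [|m] mp; rewrite ?dvdn0 // /dvdn modn_small.
Qed.

Lemma cong_leq x y m n : (m <= n)%N ->
  cong (p%:R ^+ n) x y -> cong (p%:R ^+ m) x y.
Proof.
move=> /subnKC <- [c h]; exists (p%:R ^+ (n - m) * c).
by rewrite mulrA -exprD.
Qed.

Lemma fixed_point (g : Zp -> Zp) :
    (forall n x y, cong (p%:R ^+ n) x y -> cong (p%:R ^+ n.+1) (g x) (g y)) ->
  exists x, x = g x.
Proof.
move=> gc; have [n|x xu] := @padic_lim (fun n => iter n g 0).
  elim: n => [|n IHn] /=; last exact: gc.
  by exists (0 - g 0); rewrite expr0 mul1r.
exists x; apply: separated => n; apply: (cong_leq (leqnSn n)).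
exact: cong_trans (xu n.+1) (cong_sym (gc _ _ _ (xu n))).
Qed.

End PadicFacts.

(** * Groups with coordinate in the p-adic integers *)

Section FilteredGroup.

Variables (p : nat) (p_pr : prime p).
Local Notation Zp := (padic_int p_pr).
Local Notation pi := (p%:R : Zp).
Variables (G : zmodType) (zeta : G -> Zp).
Hypothesis zeta_inj : injective zeta.
Hypothesis zeta_surj : forall z, exists P, zeta P = z.
Hypothesis zeta0 : zeta 0 = 0.
Hypothesis zetaD : forall P Q, exists u,
  zeta (P + Q) = zeta P + zeta Q + pi * zeta P * zeta Q * u.
Implicit Types (P Q T : G) (a b c u : Zp).

Definition level n P := exists c, zeta P = pi ^+ n * c.
Definition exact_level n P := exists2 u, u \is a GRing.unit & zeta P = pi ^+ n * u.

Lemma level0 P : level 0 P.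
Proof. by exists (zeta P); rewrite expr0 mul1r. Qed.

Lemma exact_levelW n P : exact_level n P -> level n P.
Proof. by case=> u _ h; exists u. Qed.

(** The difference of the coordinates is [zeta (P - Q)] times a unit, so the filtration of the group
    induces the p-adic distance, and [G] inherits completeness. *)
Lemma levelE n P Q : level n (P - Q) <-> cong (pi ^+ n) (zeta P) (zeta Q).
Proof.
have [u zP] := zetaD Q (P - Q); rewrite addrC subrK in zP.
have uu := unit1D (zeta Q * u); rewrite mulrA in uu.
have zB : zeta P - zeta Q = zeta (P - Q) * (1 + pi * zeta Q * u).
  by rewrite zP; ring.
split=> [[c h]|[c h]]; first by exists (c * (1 + pi * zeta Q * u)); rewrite zB h mulrA.
exists (c / (1 + pi * zeta Q * u)); apply: (mulIr uu).
by rewrite -zB h mulrA divrK.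
Qed.

Lemma level_zero n : level n 0.
Proof. by exists 0; rewrite mulr0. Qed.

Lemma levelD n P Q : level n P -> level n Q -> level n (P + Q).
Proof.
case=> a ha [b hb]; have [u h] := zetaD P Q.
by exists (a + b + pi * a * pi ^+ n * b * u); rewrite h ha hb; ring.
Qed.

Lemma levelN n P : level n P -> level n (- P).
Proof.
move=> h; rewrite -sub0r; apply/levelE/cong_sym/levelE.
by rewrite subr0.
Qed.

Lemma level_leq m n P : (m <= n)%N -> level n P -> level m P.
Proof.
move=> /subnKC <- [c h]; exists (pi ^+ (n - m) * c).
by rewrite mulrA -exprD.
Qed.

Lemma level_separated P : (forall n, level n P) -> P = 0.
Proof.
move=> h; apply: zeta_inj; apply: separated => n; apply/levelE.
by rewrite subr0.
Qed.

Lemma zetaMn P m : exists u, zeta (P *+ m) = m%:R * zeta P + pi * zeta P ^+ 2 * u.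
Proof.
elim: m => [|m [u IHm]]; first by exists 0; rewrite mulr0n zeta0; ring.
rewrite mulrS; have [v ->] := zetaD P (P *+ m); rewrite IHm.
exists (u + (m%:R + pi * zeta P * u) * v); rewrite -natr1; ring.
Qed.

Lemma levelMn n P m : level n P -> level n (P *+ m).
Proof.
case=> c h; have [u zm] := zetaMn P m.
by exists (m%:R * c + pi * c ^+ 2 * pi ^+ n * u); rewrite zm h; ring.
Qed.

Lemma levelMp n P : level n P -> level n.+1 (P *+ p).
Proof.
case=> c h; have [u zp] := zetaMn P p.
by exists (c + c ^+ 2 * pi ^+ n * u); rewrite zp h [pi ^+ n.+1]exprS; ring.
Qed.

Lemma levelMpn n P : level n (P *+ p ^ n).
Proof.
elim: n => [|n IHn]; first exact: level0.
by rewrite expnSr mulrnA; apply: levelMp.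
Qed.

(** * Multiplication by p-adic integers *)

Lemma level_mulr_cong n P (m m' : nat) :
  cong (pi ^+ n) m%:R m'%:R -> level n (P *+ m - P *+ m').
Proof.
wlog le_m : m m' / (m' <= m)%N.
  move=> h; case/orP: (leq_total m' m) => [|le_m] c; first by move/h; apply.
  by rewrite -opprB; apply/levelN/h/cong_sym.
move=> /congP; rewrite !residue_nat => /eqP; rewrite eqz_mod_dvd.
rewrite subzn // dvdzE abszX !absz_nat -mulrnBr // => /dvdnP[k ->].
by rewrite mulrnA; apply: levelMpn.
Qed.

(** The multiples of [P] by integers approximating [a] form a Cauchy sequence; [Q] is its limit. *)
Lemma ex_pmul P a : exists Q, forall n (m : nat),
  cong (pi ^+ n) a m%:R -> level n (Q - P *+ m).
Proof.
have [m am] := choice (@cong_nat p p_pr a).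
have [|l lm] := @padic_lim p p_pr (fun n => zeta (P *+ m n)).
  move=> n; apply/levelE/level_mulr_cong; apply: cong_trans (cong_sym (am n)) _.
  exact: cong_leq (leqnSn n) (am n.+1).
have [Q zQ] := zeta_surj l; exists Q => n k ak.
rewrite -(subrKA (P *+ m n)); apply: levelD; first by apply/levelE; rewrite zQ.
exact/level_mulr_cong/(cong_trans (cong_sym (am n))).
Qed.

Definition pmul P a := sval (cid (ex_pmul P a)).

Lemma pmulP P a n (m : nat) : cong (pi ^+ n) a m%:R -> level n (pmul P a - P *+ m).
Proof. by rewrite /pmul; case: cid => Q /= h /h. Qed.

Lemma pmul_unique P a Q :
    (forall n, exists2 m : nat, cong (pi ^+ n) a m%:R & level n (Q - P *+ m)) ->
  Q = pmul P a.
Proof.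
move=> h; apply/eqP; rewrite -subr_eq0; apply/eqP/level_separated => n.
have [m am lm] := h n; rewrite -(subrKA (P *+ m)); apply: levelD => //.
by rewrite -opprB; apply/levelN/pmulP.
Qed.

Lemma pmulD P : {morph pmul P : a b / a + b}.
Proof.
move=> a b; apply/esym/pmul_unique => n.
have [m am] := cong_nat a n; have [k bk] := cong_nat b n.
exists (m + k)%N; first by rewrite natrD; apply: congD.
by rewrite mulrnDr opprD addrACA; apply/levelD/pmulP/bk/pmulP.
Qed.

Lemma pmul_nat P (m : nat) : pmul P m%:R = P *+ m.
Proof.
apply/esym/pmul_unique => n; exists m; first exact: cong_refl.
by rewrite subrr; apply: level_zero.
Qed.

Lemma pmulMn P a m : pmul P (a *+ m) = pmul P a *+ m.
Proof.
elim: m => [|m IHm]; first by rewrite !mulr0n -(mulr0n P) -pmul_nat.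
by rewrite !mulrS pmulD IHm.
Qed.

Lemma pmulB P a b : pmul P (a - b) = pmul P a - pmul P b.
Proof. by apply/eqP; rewrite eq_sym subr_eq -pmulD subrK. Qed.

Lemma exact_cong n P Q : exact_level n P -> level n.+1 (Q - P) -> exact_level n Q.
Proof.
case=> u uu zP /levelE[c h]; exists (u * (1 + pi * (c / u))).
  by rewrite unitrM uu unit1D.
rewrite mulrDr mulr1 mulrCA [u * _]mulrC divrK // mulrDr mulrA -exprSr -h zP.
by rewrite addrC subrK.
Qed.

Lemma exactMn n P (m : nat) : exact_level n P -> ~~ (p %| m)%N -> exact_level n (P *+ m).
Proof.
case=> u uu zP; rewrite -(unit_nat p_pr) => um; have [v zm] := zetaMn P m.
exists (m%:R * u * (1 + pi * (u / m%:R * pi ^+ n * v))).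
  by rewrite !unitrM um uu unit1D.
rewrite zm zP mulrDr mulr1 mulrDr; congr (_ + _); first by ring.
have := divrK um u; move: (u / _) => x <-; ring.
Qed.

Lemma exact_leq i j P : exact_level i P -> level j P -> (j <= i)%N.
Proof.
case=> u uu zP [c h]; rewrite leqNgt; apply/negP => ij.
have /negP[] := nunit_pM (pi ^+ (j - i.+1) * c).
rewrite (_ : pi * _ = u) //; apply: (mulfI (expf_neq0 i (p_neq0 p_pr))).
by rewrite -zP h !mulrA -exprSr -exprD subnKC.
Qed.

(** The quadratic error in [zetaMn] has valuation at least 2n + 1, beyond that of the main term, n +
    1, exactly when n > 0. At level 0 the two may cancel. *)
Lemma exactMp_gt0 n Q : (0 < n)%N -> exact_level n Q -> exact_level n.+1 (Q *+ p).
Proof.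
case: n => // n _ [u uu zQ]; have [v zp] := zetaMn Q p.
exists (u * (1 + pi * (pi ^+ n * u * v))); first by rewrite unitrM uu unit1D.
by rewrite zp zQ [pi ^+ n.+2]exprS [pi ^+ n.+1]exprS; ring.
Qed.

(** * The subgroup of level [k] is free of rank one *)

Section Multiples.

Variables (k : nat) (P0 : G).
Hypothesis P0_exact : exact_level k P0.
Hypothesis exactMp : forall n Q, (k <= n)%N -> exact_level n Q -> exact_level n.+1 (Q *+ p).

Lemma exactMpn n Q : exact_level k Q -> exact_level (k + n) (Q *+ p ^ n).
Proof.
move=> h; elim: n => [|n IHn]; first by rewrite addn0.
by rewrite expnSr mulrnA addnS; apply: exactMp => //; apply: leq_addr.
Qed.

Lemma pmul_exact n u : u \is a GRing.unit -> exact_level (k + n) (pmul P0 (pi ^+ n * u)).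
Proof.
move=> uu; rewrite -natrX mulr_natl pmulMn; apply: exactMpn.
have [m um] := cong_nat u k.+1; apply: exact_cong (pmulP P0 um).
apply: exactMn => //; rewrite -(unit_nat p_pr) unit_residue1.
have /congP <- := cong_leq (ltn0Sn k : 1 <= k.+1)%N um.
by rewrite -unit_residue1.
Qed.

Lemma pmul_level n a : level (k + n) (pmul P0 a) -> cong (pi ^+ n) a 0.
Proof.
have [->|/padic_val[m [u [uu ->]]]] := eqVneq a 0; first by move=> _; apply: cong_refl.
move/(exact_leq (pmul_exact m uu)); rewrite leq_add2l => mn.
by apply: (cong_leq mn); exists u; rewrite subr0.
Qed.

Lemma pmul_inj : injective (pmul P0).
Proof.
move=> a b ab; apply/eqP; rewrite -subr_eq0; apply/eqP/separated => n.
by apply: pmul_level; rewrite pmulB ab subrr; apply: level_zero.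
Qed.

Lemma pmul_approx Q n : level k Q -> exists m : nat, level (k + n) (Q - P0 *+ m).
Proof.
move=> hQ; elim: n => [|n [m [c zm]]]; first by exists 0%N; rewrite addn0 subr0.
have [u uu zp] := exactMpn n P0_exact.
(* [d] is the next p-adic digit: [c - d u] is divisible by p. *)
have [d [e cd]] := cong_nat (c / u) 1.
exists (m + p ^ n * d)%N; rewrite mulrnDr opprD addrA mulrnA; apply/levelE.
have [v ->] := zetaMn (P0 *+ p ^ n) d; rewrite zm zp.
exists (e * u - pi ^+ (k + n) * u ^+ 2 * v).
have cE : c = (d%:R + pi * e) * u by rewrite -(divrK uu c) -[pi]expr1 -cd addrC subrK.
by rewrite cE addnS [pi ^+ (k + n).+1]exprS; ring.
Qed.

Lemma pmul_surj Q : level k Q -> exists a, pmul P0 a = Q.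
Proof.
move=> hQ; have [m mQ] := choice (fun n => pmul_approx n hQ).
have [|a am] := @padic_lim p p_pr (fun n => (m n)%:R).
  move=> n; have [c h] : cong (pi ^+ n) ((m n)%:R - (m n.+1)%:R) 0.
    apply: pmul_level; rewrite pmulB !pmul_nat.
    rewrite -[X in level _ X](subrKA Q) -opprB; apply: levelD; first exact: levelN.
    by apply: (level_leq _ (mQ n.+1)); rewrite leq_add2l.
  by exists c; rewrite -h subr0.
exists a; apply/esym/pmul_unique => n; exists (m n) => //.
exact: (level_leq (leq_addl k n)).
Qed.

Lemma level_pmul a : level k (pmul P0 a).
Proof.
have [m am] := cong_nat a k; rewrite -(subrK (P0 *+ m) (pmul P0 a)).
exact: levelD (pmulP P0 am) (levelMn m (exact_levelW P0_exact)).
Qed.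

End Multiples.

(** * The two possible group structures *)

Lemma isomorphism_cyclic :
    (forall Q, zeta Q \is a GRing.unit -> exact_level 1 (Q *+ p)) ->
  exists phi : Zp -> G, [/\ {morph phi : a b / a + b}, injective phi
    & forall Q, exists a, phi a = Q].
Proof.
move=> h; have [P zP] := zeta_surj 1.
have P_exact : exact_level 0 P by exists 1; rewrite ?unitr1 // zP expr0 mulr1.
have hM n Q : (0 <= n)%N -> exact_level n Q -> exact_level n.+1 (Q *+ p).
  case: n => [|n] _; last exact: exactMp_gt0.
  by case=> u uu zQ; apply: h; rewrite zQ expr0 mul1r.
exists (pmul P); split; [exact: pmulD | exact: pmul_inj hM |].
by move=> Q; apply: (pmul_surj P_exact hM); apply: level0.
Qed.

Lemma isomorphism_split :
    (exists2 Q, zeta Q \is a GRing.unit & level 2 (Q *+ p)) ->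
  exists phi : (Zp * Zmodp p_pr)%type -> G, [/\ {morph phi : x y / x + y},
    injective phi & forall Q, exists x, phi x = Q].
Proof.
case=> Q uQ lQ; have [P zP] := zeta_surj pi.
have P_exact : exact_level 1 P by exists 1; rewrite ?unitr1 // zP expr1 mulr1.
have hM n R : (1 <= n)%N -> exact_level n R -> exact_level n.+1 (R *+ p) := @exactMp_gt0 n R.
have [a Pa] := pmul_surj P_exact hM (level_leq (leqnSn 1) lQ).
(* As pQ has level 2 and [P] only level 1, [a] is p times some [b]. Subtracting bP from [Q] gives a
   p-torsion point [T] that still has a unit coordinate and so splits off the level-1 subgroup. *)
have [b ab] : cong (pi ^+ 1) a 0 by apply: (pmul_level P_exact hM); rewrite Pa.
pose T := Q - pmul P b.
have Tp : T *+ p = 0.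
  by rewrite mulrnBl -pmulMn -Pa -[a]subr0 ab expr1 mulr_natl subrr.
have TQ : level 1 (T - Q) by rewrite /T addrC addKr; apply/levelN/level_pmul.
have [t ut zT] : exact_level 0 T.
  by apply: exact_cong TQ; exists (zeta Q); rewrite // expr0 mul1r.
rewrite expr0 mul1r in zT.
have Tmod m : T *+ (m %% p) = T *+ m.
  by rewrite {2}(divn_eq m p) mulrnDr mulnC mulrnA Tp mul0rn add0r.
have zTM m : cong pi (zeta (T *+ m)) (m%:R * t).
  have [v ->] := zetaMn T m; exists (t ^+ 2 * v); rewrite zT; ring.
exists (fun x => pmul P x.1 + T *+ (x.2 : 'F_p)); split.
- move=> [x1 x2] [y1 y2] /=; rewrite pmulD addrACA -mulrnDr; congr (_ + _).
  by rewrite -[RHS]Tmod -(congr1 (modn _) (Fp_cast p_pr)).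
- move=> [x1 x2] [y1 y2] /= xy.
  have xy1 : T *+ (x2 : 'F_p) - T *+ (y2 : 'F_p) = pmul P (y1 - x1).
    apply/eqP; rewrite subr_eq pmulB addrAC -xy [_ + T *+ _]addrC.
    by rewrite addrK.
  have lxy : level 1 (T *+ (x2 : 'F_p) - T *+ (y2 : 'F_p)).
    by rewrite xy1; apply: level_pmul.
  have x2y2 : x2 = y2.
    have ltp (v : 'F_p) : (v < p)%N by rewrite -[X in (_ < X)%N](Fp_cast p_pr).
    have [c h] : cong pi ((x2 : 'F_p)%:R * t) ((y2 : 'F_p)%:R * t).
      apply: cong_trans (cong_sym (zTM _)) (cong_trans _ (zTM _)).
      by rewrite -[pi]expr1; apply/levelE.
    have /congP : cong (pi ^+ 1) (x2 : 'F_p)%:R (y2 : 'F_p)%:R.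
      exists (c / t); rewrite expr1 mulrA -h -mulrBl mulrK //.
    rewrite !residue_nat expr1 !modz_nat => -[].
    by rewrite !modn_small ?ltp // => /val_inj.
  by move: xy; rewrite x2y2 => /addIr /(pmul_inj P_exact hM) ->.
move=> R; have [d [e cd]] := cong_nat (zeta R / t) 1.
have lR : level 1 (R - T *+ (inZp d : 'F_p)).
  have -> : T *+ (inZp d : 'F_p) = T *+ d.
    by rewrite -[RHS]Tmod -(congr1 (modn _) (Fp_cast p_pr)).
  apply/levelE; rewrite expr1; apply: cong_trans (cong_sym (zTM d)).
  by exists (e * t); rewrite mulrA -[pi]expr1 -cd mulrBl divrK.
have [c Pc] := pmul_surj P_exact hM lR.
by exists (c, inZp d); rewrite /= Pc subrK.
Qed.

End FilteredGroup.

(** * The reduced curve, a cuspidal cubic *)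

Section CuspidalCubic.

Variable F : fieldType.
Implicit Type v : 'I_3 -> F.

Lemma mderivXU n (R : comNzRingType) (i j : 'I_n) :
  mderiv i 'X_j = (j == i)%:R :> {mpoly R[n]}.
Proof.
rewrite mderivX mnm1E; have [->|_] := eqVneq j i; last by rewrite scale0r.
have -> : (U_(i) - U_(i))%MM = 0%MM by apply/mnmP => k; rewrite mnmBE subnn mnmE.
by rewrite mpolyX0 scale1r.
Qed.

Lemma ord3_ind (P : 'I_3 -> Prop) :
  P (inord 0) -> P (inord 1) -> P (inord 2) -> forall i, P i.
Proof.
move=> h0 h1 h2 i; rewrite -(inord_val i).
by case: i => [[|[|[|i]]] lti].
Qed.

Lemma tnth3 (T : Type) (a b c : T) :
  [/\ tnth [tuple a; b; c] (inord 0) = a, tnth [tuple a; b; c] (inord 1) = b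
    & tnth [tuple a; b; c] (inord 2) = c].
Proof. by rewrite !(tnth_nth a) !inordK. Qed.

Lemma cusp_form : cubic_form (Weierstrass 0 0 0 0 (0 : F)) =
  'X_(inord 1) ^+ 2 * 'X_(inord 2) - 'X_(inord 0) ^+ 3.
Proof. by rewrite /cubic_form /= !scale0r !addr0. Qed.

(** Vanishing of the Y-coordinate forces that of the X-coordinate, and then of all partial
    derivatives. Conversely the Z-derivative is Y^2, which detects nonsingularity in every
    characteristic. *)
Lemma nonsingular_cusp v : nonsingular_point (Weierstrass 0 0 0 0 0) v <->
  v (inord 1) != 0 /\ v (inord 1) ^+ 2 * v (inord 2) = v (inord 0) ^+ 3.
Proof.
rewrite /nonsingular_point cusp_form.
have eqv : ('X_(inord 1) ^+ 2 * 'X_(inord 2) - 'X_(inord 0) ^+ 3).@[v] =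
    v (inord 1) ^+ 2 * v (inord 2) - v (inord 0) ^+ 3.
  by rewrite mevalB mevalM !rmorphXn /= !mevalXU.
have eqd i : (mderiv i ('X_(inord 1) ^+ 2 * 'X_(inord 2) - 'X_(inord 0) ^+ 3)).@[v]
  = 2 * (inord 1 == i)%:R * v (inord 1) * v (inord 2)
    + (inord 2 == i)%:R * v (inord 1) ^+ 2
    - 3 * (inord 0 == i)%:R * v (inord 0) ^+ 2.
  rewrite mderivB !exprS expr0 !mulr1 !mderivM !mderivXU.
  rewrite mevalB !(mevalD, mevalM, mevalXU, rmorph_nat).
  by ring.
rewrite eqv; split=> [[_ /eqP]|[v1 v2]].
  rewrite subr_eq0 => /eqP v2 [i]; rewrite eqd => di; split=> //.
  apply: contraNneq di => v1; move: v2; rewrite v1 expr0n mul0r => /esym/eqP.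
  by rewrite expf_eq0 => /eqP ->; rewrite expr0n !mulr0 mul0r addr0 subr0.
split; [by exists (inord 1) | by rewrite v2 subrr|].
exists (inord 2); rewrite eqd.
have ne (a b : nat) : (a < 3)%N -> (b < 3)%N -> a != b -> (inord a == inord b :> 'I_3) = false.
  by move=> la lb /negPf ab; apply/eqP => /(congr1 val) /=; rewrite !inordK // => /eqP; rewrite ab.
by rewrite eqxx (ne 1%N 2%N) // (ne 0%N 2%N) // mul1r !mulr0 !mul0r add0r subr0 expf_neq0.
Qed.

End CuspidalCubic.

(** * The points of non-singular reduction *)

(* A copy of [T] free of algebraic structures, on which the group law of the curve
   can be declared as the addition. *)
Record carrier (T : Type) := Carrier { val_carrier : T }.

HB.instance Definition _ (T : Type) := [isNew for @val_carrier T].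
HB.instance Definition _ (T : choiceType) := [Choice of carrier T by <:].

Section AdditiveReduction.

Variables (p : nat) (p_pr : prime p).
Local Notation Zp := (padic_int p_pr).
Local Notation pi := (p%:R : Zp).
Variables (b1 b2 b3 b4 b6 : Zp) (w : Zp -> Zp).
Hypothesis wE : forall z, w z = zw_cubic pi b1 b2 b3 b4 b6 z (w z).

Local Notation zadd := (zadd pi b1 b2 b3 b4 b6 w).
Local Notation zneg := (zneg pi b1 b2 b3 b4 b6 w).
Local Notation E :=
  (Weierstrass (pi * b1) (pi * b2) (pi * b3) (pi * b4) (pi * b6)).
Local Notation Qp := (padic_num p_pr).
Local Notation f := (@FracField.tofrac Zp : {rmorphism Zp -> Qp}).

Lemma tofrac_inj : injective (f : Zp -> Qp).
Proof. by move=> x y /eqP; rewrite /= tofrac_eq => /eqP. Qed.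

Local Notation psi := (psi w f).

Definition gadd (P Q : carrier Zp) := Carrier (zadd (val_carrier P) (val_carrier Q)).
Definition gopp (P : carrier Zp) := Carrier (zneg (val_carrier P)).

Lemma gaddA : associative gadd.
Proof.
move=> P Q T; rewrite /gadd /=.
by rewrite (zaddA (@unit1D p p_pr) wE tofrac_inj (p_neq0 p_pr) (p_nunit p_pr)
  (@separated p p_pr)).
Qed.

Lemma gaddC : commutative gadd.
Proof. by move=> P Q; rewrite /gadd (zaddC (@unit1D p p_pr) wE). Qed.

Lemma gadd0 : left_id (Carrier 0) gadd.
Proof. by case=> z; congr Carrier; apply: (zadd0 (@unit1D p p_pr) wE). Qed.

Lemma gaddN : left_inverse (Carrier 0) gopp gadd.
Proof. by move=> P; congr Carrier; apply: (zaddN (@unit1D p p_pr) wE). Qed.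

Definition formal_group : zmodType :=
  HB.pack_for zmodType (carrier Zp)
    (GRing.isZmodule.Build (carrier Zp) gaddA gaddC gadd0 gaddN).

Local Notation G := formal_group.
Let zeta (P : G) : Zp := val_carrier P.

Lemma zeta_inj : injective zeta.
Proof. by move=> [x] [y] /= ->. Qed.

Lemma zeta_surj z : exists P : G, zeta P = z.
Proof. by exists (Carrier z : G). Qed.

Lemma zetaD (P Q : G) : exists u,
  zeta (P + Q) = zeta P + zeta Q + pi * zeta P * zeta Q * u.
Proof. exact: (zaddE (@unit1D p p_pr) wE). Qed.

(** * Multiplication by p modulo p^2 *)

Definition sum2 m := (\sum_(i < m) i)%N.
Definition sum3 m := (\sum_(i < m) i * i.+1)%N.
Definition sum4 m := (\sum_(i < m) (2 * i ^ 3 + 3 * i ^ 2 + 2 * i))%N.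
Definition sum5 m := (\sum_(i < m) i * i.+1 * (i ^ 2 + i + 1))%N.
Definition sum7 m := (\sum_(i < m) i * i.+1 * (i ^ 2 + i + 1) ^ 2)%N.

(** The quotients (m^k - m)/c are defined as sums because c may be p, and because their increments
    are, up to sign, the coefficients of [add_defect] at (z, m z). *)
Lemma sum2E m : (sum2 m * 2 + m = m ^ 2)%N.
Proof.
elim: m => [|m IHm]; first by rewrite /sum2 big_ord0.
by rewrite /sum2 big_ord_recr /= -/(sum2 m); nia.
Qed.

Lemma sum3E m : (sum3 m * 3 + m = m ^ 3)%N.
Proof.
elim: m => [|m IHm]; first by rewrite /sum3 big_ord0.
by rewrite /sum3 big_ord_recr /= -/(sum3 m); nia.
Qed.

Lemma sum4E m : (sum4 m * 2 + m = m ^ 4)%N.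
Proof.
elim: m => [|m IHm]; first by rewrite /sum4 big_ord0.
by rewrite /sum4 big_ord_recr /= -/(sum4 m); nia.
Qed.

Lemma sum5E m : (sum5 m * 5 + m = m ^ 5)%N.
Proof.
elim: m => [|m IHm]; first by rewrite /sum5 big_ord0.
by rewrite /sum5 big_ord_recr /= -/(sum5 m); nia.
Qed.

Lemma sum7E m : (sum7 m * 7 + m = m ^ 7)%N.
Proof.
elim: m => [|m IHm]; first by rewrite /sum7 big_ord0.
by rewrite /sum7 big_ord_recr /= -/(sum7 m); nia.
Qed.

(* To first order in the coefficients, the logarithm of the group is z + l(z) with
   l(z) = a1 z^2 / 2 + a2 z^3 / 3 + a3 z^4 / 2 + 2 a4 z^5 / 5 + 3 a6 z^7 / 7, and
   [p%:R * mul_defect m z] is m l(z) - l(m z). *)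
Definition mul_defect (m : nat) z : Zp :=
  mul_defect_form b1 b2 b3 b4 b6 z (sum2 m)%:R (sum3 m)%:R (sum4 m)%:R
    (sum5 m)%:R (sum7 m)%:R.

Lemma zeta_mulrn (P : G) m :
  cong (pi ^+ 2) (zeta (P *+ m)) (m%:R * zeta P + pi * mul_defect m (zeta P)).
Proof.
elim: m => [|m IHm].
  rewrite /mul_defect /mul_defect_form /sum2 /sum3 /sum4 /sum5 /sum7 !big_ord0 mulr0n.
  by exists 0; rewrite /zeta /=; ring.
rewrite mulrS; set z := zeta P; set y := zeta (P *+ m).
have yz : cong pi y (m%:R * z).
  have [c h] := IHm; exists (pi * c + mul_defect m z).
  by rewrite mulrDr mulrA -expr2 -h -/y -/z; ring.
pose X := add_defect b1 b2 b3 b4 b6 z.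
have -> : m.+1%:R * z + pi * mul_defect m.+1 z =
    z + (m%:R * z + pi * mul_defect m z) + pi * X (m%:R * z).
  rewrite /mul_defect /mul_defect_form /sum2 /sum3 /sum4 /sum5 /sum7 !big_ord_recr /=.
  by rewrite /X /add_defect !natrD !natrM -natr1; ring.
apply: cong_trans (zadd_mod2 (@unit1D p p_pr) wE z y) _.
apply: congD; first exact: congD (cong_refl _ _) IHm.
exact/congMpi/add_defect_congr.
Qed.

Lemma cong_sum0 S c k : (0 < k)%N -> prime c -> c <> p ->
  (S * c + p = p ^ k)%N -> cong pi S%:R 0.
Proof.
move=> k0 c_pr cp h.
have pS : (p %| S)%N.
  rewrite -(Gauss_dvdl _ (_ : coprime p c)); last first.
    by rewrite prime_coprime // dvdn_prime2 //; apply/eqP => pc; case: cp.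
  by rewrite -(dvdn_addl _ (dvdnn p)) h dvdn_exp.
have /dvdnP[d ->] := pS; exists d%:R; rewrite natrM; ring.
Qed.

Lemma cong_sumN1 S c k : (1 < k)%N -> c = p ->
  (S * c + p = p ^ k)%N -> cong pi S%:R (- 1).
Proof.
case: k => [|[|k]] // _ -> h; exists (p ^ k)%:R.
rewrite opprK natr1 -natrM -expnS; congr _%:R; apply/eqP.
by rewrite -(eqn_pmul2r (prime_gt0 p_pr)) mulSn addnC h expnSr.
Qed.

Lemma cong_fermat n z : n = p -> cong pi (z ^+ n) z.
Proof.
move=> ->.
have [m] := cong_nat z 1; rewrite expr1 => zm.
apply: cong_trans (congX p zm) (cong_trans _ (cong_sym zm)).
rewrite -natrX -[pi]expr1; apply/congP; rewrite !residue_nat expr1 !modz_nat.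
by rewrite fermat_little.
Qed.

Lemma in_ideal_sq x : in_ideal (p * p) (pi * x) <-> cong pi x 0.
Proof.
rewrite /in_ideal natrM; split=> [[c h]|[c h]]; exists c.
  by rewrite subr0; apply: (mulfI (p_neq0 p_pr)); rewrite h mulrA.
by rewrite -[x]subr0 h mulrA.
Qed.

Lemma cong0_lin x t u k : t = u * x + pi * k -> cong pi x 0 -> cong pi t 0.
Proof. by move=> -> [c]; rewrite subr0 => ->; exists (u * c + k); ring. Qed.

(** The sum with denominator c is 0 modulo p if c differs from p, and p^(k-1) - 1, hence -1, if c =
    p. The surviving power of z reduces to z by Fermat. *)
Lemma first_order :
  exists t, (special_case E <-> cong pi t 0) /\
    forall z, cong pi (z + mul_defect p z) (z * t).
Proof.
have s2 := sum2E p; have s3 := sum3E p; have s4 := sum4E p.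
have s5 := sum5E p; have s7 := sum7E p.
have form_congr := @mul_defect_form_congr Zp b1 b2 b3 b4 b6 pi.
have zero := @cong_sum0; have neg1 := @cong_sumN1.
(* [x] and [t] are unit multiples of each other modulo p: [u] and [u'] are inverse residues (2 and 3
   modulo 5, 3 and 5 modulo 7), and [k], [k'] are the carries. *)
have special x t u k u' k' m a : m = (p * p)%N -> a = pi * x ->
    t = u * x + pi * k -> x = u' * t + pi * k' -> in_ideal m a <-> cong pi t 0.
  move=> -> -> tE xE; apply: (iff_trans (in_ideal_sq x)).
  by split; apply: cong0_lin; eassumption.
rewrite /special_case.
have [e2|n2] := eqVneq p 2%N.
  have piE : pi = 2 := congr1 (fun n => n%:R) e2.
  have other q : p = q -> q = 2%N by move=> <-.
  exists (1 + b1 + b3); split.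
    have <- := special (b1 + b3 - 1) _ 1 1 1 (-1) 4%N
      (pi * b1 + pi * b3 - 2); rewrite ?e2 ?piE //; try ring.
    by split=> [[[_ h]|[e _]|[e _]|[e _]]|h] //; do ?[by have := other _ e]; constructor 1.
  move=> z; apply: (@cong_trans _ _ _
      (z + mul_defect_form b1 b2 b3 b4 b6 z (-1) 0 (-1) 0 0)).
    apply: congD (cong_refl _ _) (form_congr _ _ _ _ _ _ _ _ _ _ _ _ _ _ _ _).
    - by apply: neg1 s2.
    - by apply: zero s3 => //; rewrite e2.
    - by apply: neg1 s4.
    - by apply: zero s5 => //; rewrite e2.
    - by apply: zero s7 => //; rewrite e2.
  (* The a_3 term uses z^4 - z = (z^2 - z)(z^2 + z + 1). *)
  have [c h] := cong_fermat z (esym e2); exists (c * (b1 + b3 * (z ^+ 2 + z + 1))).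
  by rewrite mulrA -h /mul_defect_form; ring.
have [e3|n3] := eqVneq p 3%N.
  have piE : pi = 3 := congr1 (fun n => n%:R) e3.
  have other q : p = q -> q = 3%N by move=> <-.
  exists (1 + b2); split.
    have <- := special (b2 - 2) _ 1 1 1 (-1) 9%N
      (pi * b2 - 6); rewrite ?e3 ?piE //; try ring.
    by split=> [[[e _]|[_ h]|[e _]|[e _]]|h] //; do ?[by have := other _ e]; constructor 2.
  move=> z; apply: (@cong_trans _ _ _
      (z + mul_defect_form b1 b2 b3 b4 b6 z 0 (-1) 0 0 0)).
    apply: congD (cong_refl _ _) (form_congr _ _ _ _ _ _ _ _ _ _ _ _ _ _ _ _).
    - by apply: zero s2 => //; rewrite e3.
    - by apply: neg1 s3.
    - by apply: zero s4 => //; rewrite e3.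
    - by apply: zero s5 => //; rewrite e3.
    - by apply: zero s7 => //; rewrite e3.
  have [c h] := cong_fermat z (esym e3); exists (c * b2).
  by rewrite mulrA -h /mul_defect_form; ring.
have [e5|n5] := eqVneq p 5%N.
  have piE : pi = 5 := congr1 (fun n => n%:R) e5.
  have other q : p = q -> q = 5%N by move=> <-.
  exists (1 + 2 * b4); split.
    have <- := special (b4 - 2) _ 2 1 3 (- (b4 + 1)) 25%N
      (pi * b4 - 10); rewrite ?e5 ?piE //; try ring.
    by split=> [[[e _]|[e _]|[_ h]|[e _]]|h] //; do ?[by have := other _ e]; constructor 3.
  move=> z; apply: (@cong_trans _ _ _
      (z + mul_defect_form b1 b2 b3 b4 b6 z 0 0 0 (-1) 0)).
    apply: congD (cong_refl _ _) (form_congr _ _ _ _ _ _ _ _ _ _ _ _ _ _ _ _).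
    - by apply: zero s2 => //; rewrite e5.
    - by apply: zero s3 => //; rewrite e5.
    - by apply: zero s4 => //; rewrite e5.
    - by apply: neg1 s5.
    - by apply: zero s7 => //; rewrite e5.
  have [c h] := cong_fermat z (esym e5); exists (c * (2 * b4)).
  by rewrite mulrA -h /mul_defect_form; ring.
have [e7|n7] := eqVneq p 7%N.
  have piE : pi = 7 := congr1 (fun n => n%:R) e7.
  have other q : p = q -> q = 7%N by move=> <-.
  exists (1 + 3 * b6); split.
    have <- := special (b6 - 2) _ 3 1 5 (- (2 * b6 + 1)) 49%N
      (pi * b6 - 14); rewrite ?e7 ?piE //; try ring.
    by split=> [[[e _]|[e _]|[e _]|[_ h]]|h] //; do ?[by have := other _ e]; constructor 4.
  move=> z; apply: (@cong_trans _ _ _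
      (z + mul_defect_form b1 b2 b3 b4 b6 z 0 0 0 0 (-1))).
    apply: congD (cong_refl _ _) (form_congr _ _ _ _ _ _ _ _ _ _ _ _ _ _ _ _).
    - by apply: zero s2 => //; rewrite e7.
    - by apply: zero s3 => //; rewrite e7.
    - by apply: zero s4 => //; rewrite e7.
    - by apply: zero s5 => //; rewrite e7.
    - by apply: neg1 s7.
  have [c h] := cong_fermat z (esym e7); exists (c * (3 * b6)).
  by rewrite mulrA -h /mul_defect_form; ring.
exists 1; split.
  split=> [[] [e _]|[c]]; try by rewrite e eqxx in n2 n3 n5 n7.
  by rewrite subr0 => h; have := nunit_pM c; rewrite -h unitr1.
move=> z; apply: (@cong_trans _ _ _
      (z + mul_defect_form b1 b2 b3 b4 b6 z 0 0 0 0 0)).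
  apply: congD (cong_refl _ _) (form_congr _ _ _ _ _ _ _ _ _ _ _ _ _ _ _ _).
  - by apply: zero s2 => // e; rewrite -e in n2.
  - by apply: zero s3 => // e; rewrite -e in n3.
  - by apply: zero s4 => // e; rewrite -e in n2.
  - by apply: zero s5 => // e; rewrite -e in n5.
  - by apply: zero s7 => // e; rewrite -e in n7.
by exists 0; rewrite /mul_defect_form; ring.
Qed.

Lemma isomorphism_formal_group :
  (~ special_case E -> exists phi : Zp -> G,
     [/\ {morph phi : x y / x + y}, injective phi & forall P, exists x, phi x = P]) /\
  (special_case E -> exists phi : (Zp * Zmodp p_pr)%type -> G,
     [/\ {morph phi : x y / x + y}, injective phi & forall P, exists x, phi x = P]).
Proof.
have [t [specialE tE]] := first_order.
have mulp (Q : G) : cong (pi ^+ 2) (zeta (Q *+ p)) (pi * (zeta Q * t)).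
  apply: cong_trans (zeta_mulrn Q p) _; rewrite -mulrDr.
  exact/congMpi/tE.
split=> h.
  apply: (isomorphism_cyclic zeta_inj zeta_surj (erefl _) zetaD) => Q uQ.
  have ut : t \is a GRing.unit.
    apply: contraT => /nunitP[c tc]; case: h; apply/specialE.
    by exists c; rewrite subr0.
  have [c zc] := mulp Q; have uzt : zeta Q * t \is a GRing.unit by rewrite unitrM uQ.
  exists (zeta Q * t * (1 + pi * (c / (zeta Q * t)))).
    by rewrite unitrM uzt unit1D.
  rewrite -[LHS](subrK (pi * (zeta Q * t))) zc -{1}(divrK uzt c).
  by move: (c / _) => d; ring.
apply: (isomorphism_split zeta_inj zeta_surj (erefl _) zetaD).
have [Q zQ] := zeta_surj 1; exists Q; first by rewrite zQ unitr1.
have [c tc] := (specialE.1 h); have [d zd] := mulp Q.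
exists (d + c); rewrite -[zeta _](subrK (pi * (zeta Q * t))) zd zQ -[t]subr0 tc.
ring.
Qed.

(** * Coordinates, convergence and the points of E_0 *)

Definition coords z : 'I_3 -> Zp := tnth [tuple - z; 1; - w z].
Definition kappa z : Qp := if z == 0 then 1 else - (f (w z))^-1.

Lemma kappa_neq0 z : kappa z != 0.
Proof.
rewrite /kappa; case: ifPn => [_|z0]; first exact: oner_neq0.
by rewrite oppr_eq0 invr_eq0 (fw_neq0 wE tofrac_inj).
Qed.

(** Dividing (x : y : 1) by y, which is [kappa z] off infinity, gives coordinates that are integral
    and depend continuously on [z] even at infinity. *)
Lemma homogeneous_psi z i : homogeneous (psi z) i = kappa z * f (coords z i).
Proof.
have [h0 h1 h2] := tnth3 (- z) 1 (- w z); rewrite /kappa /psi.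
case: eqP => [z0|/eqP z0].
  have [k0 k1 k2] := tnth3 0 1 (0 : Qp); rewrite mul1r /homogeneous.
  elim/ord3_ind: i; rewrite /coords ?h0 ?h1 ?h2 ?k0 ?k1 ?k2.
  - by rewrite z0 oppr0 rmorph0.
  - by rewrite rmorph1.
  - by rewrite z0 (w0 (@unit1D p p_pr) wE) oppr0 rmorph0.
have W0 := fw_neq0 wE tofrac_inj z0.
have [k0 k1 k2] := tnth3 (f z / f (w z)) (- (f (w z))^-1) 1.
elim/ord3_ind: i; rewrite /coords /homogeneous ?h0 ?h1 ?h2 ?k0 ?k1 ?k2.
- by rewrite rmorphN mulrNN mulrC.
- by rewrite rmorph1 mulr1.
- by rewrite rmorphN mulrNN mulVf.
Qed.

Lemma coords_congr d x y i : cong d x y -> cong d (coords x i) (coords y i).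
Proof.
move=> h; have [h0 h1 h2] := tnth3 (- x) 1 (- w x).
have [k0 k1 k2] := tnth3 (- y) 1 (- w y).
elim/ord3_ind: i; rewrite /coords ?h0 ?h1 ?h2 ?k0 ?k1 ?k2.
- exact: congN.
- exact: cong_refl.
- exact/congN/(w_congr (@unit1D p p_pr) wE).
Qed.

Lemma kappa_val z : exists k e, kappa z = f e / f (pi ^+ k).
Proof.
rewrite /kappa; case: eqP => [_|/eqP z0].
  by exists 0%N, 1; rewrite expr0 rmorph1 divr1.
have wz0 : w z != 0 by apply: contraNneq z0 => /(w_eq0 wE) ->.
have [k [u [uu ->]]] := padic_val wz0; exists k, (- u^-1).
by rewrite rmorphM rmorphN rmorphV // invfM mulNr mulrC.
Qed.

Lemma mulz_psi m (P : G) :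
  mulz_point (generic_fibre E) m (psi (zeta P)) = psi (zeta (P *~ m)).
Proof.
have mulnP n : iter n (add_point (generic_fibre E) (psi (zeta P))) Infinity
    = psi (zeta (P *+ n)).
  elim: n => [|n IHn]; first by rewrite mulr0n psi0.
  rewrite iterS IHn mulrS.
  exact: (psi_add (@unit1D p p_pr) wE tofrac_inj).
case: m => n; first exact: mulnP.
rewrite /mulz_point mulnP NegzE mulrNz.
exact: (opp_psi (@unit1D p p_pr) wE tofrac_inj).
Qed.

Lemma psi_cvg (u : nat -> Zp) z :
  (forall n, exists N, forall j, (N <= j)%N -> cong (pi ^+ n) (u j) z) ->
  point_cvg (fun j => psi (u j)) (psi z).
Proof.
move=> uz; exists (fun j => kappa z / kappa (u j)); split=> [j|i n].
  by rewrite mulf_neq0 ?invr_eq0 ?kappa_neq0.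
have [k [e kE]] := kappa_val z.
(* The denominator p^k of the fixed factor [kappa z] costs [k] digits of precision. *)
have [N uN] := uz (n + k)%N; exists N => j /uN/(coords_congr i)[c h]; exists (e * c).
have pk0 : f (pi ^+ k) != 0.
  by apply: contraNneq (expf_neq0 k (p_neq0 p_pr)) => /(f_eq0 tofrac_inj) ->.
rewrite !homogeneous_psi mulrA divfK ?kappa_neq0 // -mulrBr -rmorphB h kE.
apply: (mulIf pk0); rewrite mulrAC divfK // -!rmorphM; congr (f _).
by rewrite exprD; ring.
Qed.

(** The reduction is a cusp, so a nonsingular reduction means that the Y-coordinate of a primitive
    vector is a unit. Dividing by it makes z = -x/y and w = -1/y integral, and [w_unique] identifies
    the latter. *)
Lemma E0P P : E0 E P <-> exists z, psi z = P.
Proof.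
have r0 b : padic_red (pi * b) = 0 by apply/eqP; rewrite red_eq0 nunit_pM.
have special0 : special_fibre E = Weierstrass 0 0 0 0 0.
  by rewrite /special_fibre /map_weierstrass /= !r0.
rewrite /E0 special0; split=> [[onP [c [v [c0 vP /nonsingular_cusp[v1 _]]]]]|[z <-]].
  have {}v1 : v (inord 1) \is a GRing.unit.
    by apply: contraNT v1 => nu; rewrite red_eq0.
  case: P onP vP => [|x y] onP vP; first by exists 0; rewrite psi0.
  have [h0 h1 h2] := tnth3 x y 1.
  have := vP (inord 0); have := vP (inord 1); have := vP (inord 2).
  rewrite /homogeneous h0 h1 h2 mulr1 {h0 h1 h2}.
  pose z := - v (inord 0) / v (inord 1); pose u := - v (inord 2) / v (inord 1).
  have -> : v (inord 0) = - z * v (inord 1) by rewrite -mulNr opprK divrK.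
  have -> : v (inord 2) = - u * v (inord 1) by rewrite -mulNr opprK divrK.
  clearbody z u; move: (v (inord 1)) v1 => v1 uv1 cE yE xE.
  have uE : u = zw_cubic pi b1 b2 b3 b4 b6 z u.
    apply: (mulIr (unitrX 3 uv1)); apply: tofrac_inj.
    have h : (c * y) ^+ 2 * c + f (pi * b1) * (c * x) * (c * y) * c
        + f (pi * b3) * (c * y) * c ^+ 2 =
      (c * x) ^+ 3 + f (pi * b2) * (c * x) ^+ 2 * c
        + f (pi * b4) * (c * x) * c ^+ 2 + f (pi * b6) * c ^+ 3.
      by apply: (eq_lincomb (k := c ^+ 3) (eqP onP)) => /=; ring.
    rewrite xE yE cE in h; apply: (eq_lincomb (k := -1) h).
    by rewrite /zw_cubic; ring.
  have uw := w_unique (@unit1D p p_pr) wE uE.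
  have fv0 : f v1 != 0.
    by apply: contraTneq uv1 => /(f_eq0 tofrac_inj) ->; rewrite unitr0.
  have fu0 : f u != 0.
    by apply: contraNneq c0; rewrite cE rmorphM rmorphN => ->; rewrite oppr0 mul0r.
  have z0 : z != 0.
    apply: contraNneq fu0 => z0; rewrite uw z0 (w0 (@unit1D p p_pr) wE).
    by rewrite rmorph0.
  exists z; rewrite psiE // -uw; congr Affine; apply: (mulfI c0).
    by rewrite xE cE !rmorphM !rmorphN !mulNr mulrCA mulrAC divff // mul1r.
  by rewrite yE cE rmorphM rmorphN mulNr mulrNN mulrAC divff // mul1r.
split; first exact: (psi_on_curve wE tofrac_inj).
exists (kappa z)^-1, (coords z); split.
- by rewrite invr_eq0 kappa_neq0.
- by move=> i; rewrite homogeneous_psi mulKf ?kappa_neq0.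
apply/nonsingular_cusp; have [h0 h1 h2] := tnth3 (- z) 1 (- w z).
rewrite /coords h0 h1 h2 rmorph1 expr1n mul1r; split; first exact: oner_neq0.
have -> : - w z = - z ^+ 3 - pi * (b1 * z * w z + b2 * z ^+ 2 * w z + b3 * w z ^+ 2
    + b4 * z * w z ^+ 2 + b6 * w z ^+ 3) by rewrite {1}wE /zw_cubic; ring.
by rewrite rmorphB /= r0 subr0 -rmorphXn /=; congr padic_red; ring.
Qed.

(** Additivity suffices for compatibility with p-adic multiples: if m = a + p^n c, the images of m v
    and a v differ by p^n times a point, which has level n. *)
Lemma E0_isomorphicP (V : lmodType Zp) (phi : V -> G) :
    {morph phi : u v / u + v} -> injective phi ->
    (forall P, exists v, phi v = P) ->
  E0_isomorphic E V.
Proof.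
move=> phiD phi_inj phi_surj.
have phiB : zmod_morphism phi.
  by move=> u v; apply/eqP; rewrite eq_sym subr_eq -phiD subrK.
pose phiA : {additive V -> G} := HB.pack phi (GRing.isZmodMorphism.Build V G phi phiB).
exists (fun v => psi (zeta (phi v))); split.
- by move=> u v /(psi_inj wE tofrac_inj)/zeta_inj/phi_inj.
- move=> P; rewrite E0P; split=> [[z <-]|[v <-]]; last by exists (zeta (phi v)).
  by have [v vz] := phi_surj (Carrier z); exists v; rewrite vz.
- move=> u v; rewrite phiD; apply/esym.
  exact: (psi_add (@unit1D p p_pr) wE tofrac_inj).
move=> a v m ma.
have -> : (fun j => mulz_point (generic_fibre E) (m j) (psi (zeta (phi v)))) =
    (fun j => psi (zeta (phi v *~ m j))).
  by apply/funext => j; rewrite mulz_psi.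
apply: psi_cvg => n; have [N mN] := ma n; exists N => j /mN[c mc].
apply/(levelE zetaD).
have {}mc : (m j)%:~R = a + pi ^+ n * c.
  apply: tofrac_inj; rewrite rmorphD rmorph_int addrC.
  by apply/eqP; rewrite -subr_eq; apply/eqP.
have -> : phi v *~ m j - phi (a *: v) = phi (c *: v) *+ p ^ n.
  rewrite -[phi]/(phiA : V -> G) -raddfMz -raddfB -raddfMn -scaler_int mc scalerDl.
  by rewrite addrC addKr -natrX -scalerA scaler_nat.
exact: (@levelMpn p p_pr G zeta (erefl _) zetaD n (phi (c *: v))).
Qed.

End AdditiveReduction.

Theorem corollary2 (p : nat) (p_pr : prime p) (a1 a2 a3 a4 a6 : padic_int p_pr) :
  let E := Weierstrass a1 a2 a3 a4 a6 in
  discriminant E != 0 ->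
  in_ideal p a1 -> in_ideal p a2 -> in_ideal p a3 -> in_ideal p a4 ->
  in_ideal p a6 ->
  (~ special_case E -> E0_isomorphic E (padic_int p_pr)^o) /\
  (special_case E ->
   E0_isomorphic E ((padic_int p_pr)^o * Zmodp p_pr)%type).
Proof.
move=> E _ [b1 E1] [b2 E2] [b3 E3] [b4 E4] [b6 E6].
rewrite /E E1 E2 E3 E4 E6 {E E1 E2 E3 E4 E6}.
have ex_w z : exists v, v = zw_cubic p%:R b1 b2 b3 b4 b6 z v.
  apply: fixed_point => n x y [c xy].
  have := zw_cubicB p%:R b1 b2 b3 b4 b6 z z x y.
  rewrite subrr mul0r subr0 => h.
  (* The second factor is (1 - slope_den) / p, which is where the contraction gains its factor p. *)
  exists (c * (b1 * z + b2 * z ^+ 2 + b3 * (x + y) + b4 * z * (x + y)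
              + b6 * (x ^+ 2 + x * y + y ^+ 2))).
  rewrite exprS -mulrA [_ ^+ n * _]mulrA -xy.
  by apply: (eq_lincomb (k := -1) h); rewrite /slope_den; ring.
have [w wE] := choice ex_w.
have [cyclic split] := isomorphism_formal_group wE.
split=> [/cyclic|/split] [phi [phiD phi_inj phi_surj]].
  exact: (@E0_isomorphicP _ _ _ _ _ _ _ _ wE (padic_int p_pr)^o phi).
exact: (@E0_isomorphicP _ _ _ _ _ _ _ _ wE ((padic_int p_pr)^o * Zmodp p_pr)%type phi).
Qed.
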